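(* Let $\mathbf{Y}\in\mathbb{Q}^{m\times s}$ ($m>s$) have full column rank, and let $\mathbf{H}_0=\mathbf{H}\in\mathbb{Q}^{m\times s}$ be the matrix obtained from a thin complex QR decomposition $\mathbf{Y}_c=QR$ by requiring $\mathbf{H}_c=Q$. Let $\delta\in[1,\sqrt{7}/2]$ and, for $k=0,1,2$, let $$\mathbf{H}_{k+1}=(1-\epsilon_k)\mathbf{H}_k+\epsilon_k(\mathbf{H}_k^\dagger)^*,\qquad\epsilon_k\in[\sigma_s(\mathbf{H}_k),\delta\sigma_s(\mathbf{H}_k)],$$ and $\mathbf{H}_{new}=\mathbf{H}_3$. Then $\mathcal{R}(\mathbf{H}_{new})=\mathcal{R}(\mathbf{Y})$. Moreover, if $\kappa(\mathbf{H}_k)>\max\{2\sqrt{2}\delta,\,2\delta^2+1/2\}$ for $k=0,1,2$ and $\kappa(\mathbf{H})<10^8$, then $\kappa(\mathbf{H}_{new})<10$.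
   Context: $\mathbb{Q}$ denotes the real quaternions. A quaternion matrix $\mathbf{P}\in\mathbb{Q}^{m\times s}$ is written uniquely as $\mathbf{P}=P_0+P_1\mathbf{j}$ with $P_0,P_1\in\mathbb{C}^{m\times s}$ ($\mathbb{C}=\mathbb{R}+\mathbb{R}\mathbf{i}$), and its compact complex representation is $\mathbf{P}_c=\begin{bmatrix}P_0\\-\overline{P_1}\end{bmatrix}\in\mathbb{C}^{2m\times s}$. In the thin QR decomposition $\mathbf{Y}_c=QR$, $Q\in\mathbb{C}^{2m\times s}$ has orthonormal columns and $R\in\mathbb{C}^{s\times s}$ is upper triangular; writing $Q=\begin{bmatrix}Q_0\\Q_1\end{bmatrix}$ with $Q_0,Q_1\in\mathbb{C}^{m\times s}$, the matrix with $\mathbf{H}_c=Q$ is $\mathbf{H}=Q_0-\overline{Q_1}\,\mathbf{j}$. $\mathcal{R}(\cdot)$ is the right linear span of the columns, $^*$ is the conjugate transpose, $^\dagger$ is the Moore-Penrose inverse, $\sigma_1\ge\dots\ge\sigma_s$ are the singular values of an $m\times s$ quaternion matrix, and $\kappa=\sigma_1/\sigma_s$. *)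

(* Defs.v *)
From HB Require Import structures.
From mathcomp Require Import all_boot all_order all_algebra.
From mathcomp Require Import complex.
From mathcomp Require Import boolp classical_sets reals.
From mathcomp Require Import ring.

Set Implicit Arguments.
Unset Strict Implicit.
Unset Printing Implicit Defensive.

Import Order.TTheory GRing.Theory Num.Theory.
Local Open Scope ring_scope.
Local Open Scope sesquilinear_scope.

(* [Quat a b] is the quaternion a + b j, with a, b in C = R + R i. *)
Record quat (R : rcfType) := Quat { quat0 : R[i]; quat1 : R[i] }.

Section Quaternions.
Variable R : rcfType.
Implicit Types (x y z : quat R) (a b : R[i]).

Definition quat_to_pair x : R[i] * R[i] := (quat0 x, quat1 x).
Definition quat_of_pair (p : R[i] * R[i]) : quat R := Quat p.1 p.2.

Lemma quat_to_pairK : cancel quat_to_pair quat_of_pair.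
Proof. by case. Qed.

HB.instance Definition _ := Equality.copy (quat R) (can_type quat_to_pairK).
HB.instance Definition _ := Choice.copy (quat R) (can_type quat_to_pairK).

Definition addq x y := Quat (quat0 x + quat0 y) (quat1 x + quat1 y).
Definition oppq x := Quat (- quat0 x) (- quat1 x).

Lemma addqA : associative addq.
Proof. by move=> [a b] [c d] [e f]; rewrite /addq /= !addrA. Qed.
Lemma addqC : commutative addq.
Proof. by move=> [a b] [c d]; rewrite /addq /= addrC [b + d]addrC. Qed.
Lemma add0q : left_id (Quat 0 0) addq.
Proof. by move=> [a b]; rewrite /addq /= !add0r. Qed.
Lemma addNq : left_inverse (Quat 0 0) oppq addq.
Proof. by move=> [a b]; rewrite /addq /= !addNr. Qed.

HB.instance Definition _ :=
  GRing.isZmodule.Build (quat R) addqA addqC add0q addNq.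

(* Determined by j a = a^* j for a in C, and j j = -1. *)
Definition mulq x y :=
  Quat (quat0 x * quat0 y - quat1 x * (quat1 y)^*)
       (quat0 x * quat1 y + quat1 x * (quat0 y)^*).

Lemma mulqA : associative mulq.
Proof.
move=> [a b] [c d] [e f]; rewrite /mulq /=.
by rewrite !(rmorphB, rmorphD, rmorphM) /= !conjCK; congr Quat; ring.
Qed.
Lemma mul1q : left_id (Quat 1 0) mulq.
Proof. by move=> [a b]; rewrite /mulq /=; congr Quat; ring. Qed.
Lemma mulq1 : right_id (Quat 1 0) mulq.
Proof. by move=> [a b]; rewrite /mulq /= rmorph0 rmorph1; congr Quat; ring. Qed.
Lemma mulqDl : left_distributive mulq addq.
Proof. by move=> [a b] [c d] [e f]; rewrite /mulq /addq /=; congr Quat; ring. Qed.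
Lemma mulqDr : right_distributive mulq addq.
Proof.
move=> [a b] [c d] [e f]; rewrite /mulq /addq /= !rmorphD /=.
by congr Quat; ring.
Qed.
Lemma oneq_neq0 : Quat 1 0 != 0 :> quat R.
Proof. by apply/eqP => -[] /eqP; rewrite oner_eq0. Qed.

HB.instance Definition _ := GRing.Zmodule_isNzRing.Build (quat R)
  mulqA mul1q mulq1 mulqDl mulqDr oneq_neq0.

Definition qreal (r : R) : quat R := Quat (real_complex R r) 0.

Definition conjq x : quat R := Quat (quat0 x)^* (- quat1 x).

Lemma qjj : Quat 0 1 * Quat 0 1 = -1 :> quat R.
Proof.
by congr Quat; rewrite /= ?rmorph0 ?rmorph1; ring.
Qed.

Lemma qja a : Quat 0 1 * Quat a 0 = Quat a^* 0 * Quat 0 1 :> quat R.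
Proof. by congr Quat; rewrite /= ?rmorph0 ?rmorph1; ring. Qed.

Lemma mulq_conj x :
  x * conjq x = Quat (quat0 x * (quat0 x)^* + quat1 x * (quat1 x)^*) 0.
Proof.
case: x => a b; congr Quat; rewrite /= ?rmorphN ?conjCK /=; ring.
Qed.

End Quaternions.

Section QuaternionMatrices.
Variable R : realType.
Local Notation Q := (quat R).

Definition conjtrq m n (A : 'M[Q]_(m, n)) : 'M[Q]_(n, m) :=
  (map_mx (@conjq R) A)^T.

Definition compact m n (P : 'M[Q]_(m, n)) : 'M[R[i]]_(m + m, n) :=
  col_mx (map_mx (@quat0 R) P) (- map_mx (fun x : Q => (quat1 x)^*) P).

(* The product A *m x multiplies the columns of A on the right by the
   scalars x i 0, so this is the right span. *)
Definition colspanq m n (A : 'M[Q]_(m, n)) : set 'cV[Q]_m :=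
  [set A *m x | x in [set: 'cV[Q]_n]]%classic.

(* Right linear independence of the columns. *)
Definition full_col_rankq m n (A : 'M[Q]_(m, n)) : Prop :=
  forall x : 'cV[Q]_n, A *m x = 0 -> x = 0.

Definition is_pinvq m n (A : 'M[Q]_(m, n)) (X : 'M[Q]_(n, m)) : Prop :=
  [/\ A *m X *m A = A, X *m A *m X = X,
      conjtrq (A *m X) = A *m X & conjtrq (X *m A) = X *m A].

(* The matrix satisfying the four Penrose equations. *)
Definition pinvq m n (A : 'M[Q]_(m, n)) : 'M[Q]_(n, m) :=
  xget 0 [set X | is_pinvq A X]%classic.

Definition unitaryq n (U : 'M[Q]_n) : Prop :=
  conjtrq U *m U = 1%:M /\ U *m conjtrq U = 1%:M.

(* [sv 0 >= sv 1 >= ...] is the diagonal of a singular value decomposition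
   A = U Sigma V^*, continued by zeros. *)
Definition is_singvalsq m n (A : 'M[Q]_(m, n)) (sv : nat -> R) : Prop :=
  [/\ forall i j, (i <= j)%N -> sv j <= sv i,
      forall i, 0 <= sv i,
      forall i, (minn m n <= i)%N -> sv i = 0 &
      exists (U : 'M[Q]_m) (V : 'M[Q]_n),
        [/\ unitaryq U, unitaryq V &
            A = U *m (\matrix_(i, j) (qreal (sv i) *+ (i == j :> nat)))
                  *m conjtrq V]].

(* Numbered from 0: [singvalq A k] is sigma_(k+1). *)
Definition singvalq m n (A : 'M[Q]_(m, n)) : nat -> R :=
  xget (fun=> 0) [set sv | is_singvalsq A sv]%classic.

Definition sigma_maxq m n (A : 'M[Q]_(m, n)) : R := singvalq A 0.
Definition sigma_minq m n (A : 'M[Q]_(m, n)) : R := singvalq A n.-1.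
Definition kappaq m n (A : 'M[Q]_(m, n)) : R := sigma_maxq A / sigma_minq A.

End QuaternionMatrices.

Definition thin_QR (R : rcfType) m n
    (A Q : 'M[R[i]]_(m, n)) (T : 'M[R[i]]_n) : Prop :=
  [/\ A = Q *m T, Q ^t* *m Q = 1%:M &
      forall i j : 'I_n, (j < i)%N -> T i j = 0].

(* Main.v *)
(* If A = U diag(d) V* with all d_i > 0, then (1 - e) A + e (A^+)* =
   U diag(f(d)) V* with f(x) = (1 - e) x + e / x.  The iterates thus share
   their column space as long as f has no zero on [p, q], where p and q are
   the extreme singular values; this is [zero_free].
   Initially p <= 1 <= q <= sqrt 2, because |H x| = |x| for complex x.
   If e <= 1, convexity of f bounds the new extremes by those of f(p) and f(q),
   which is enough to keep the zero excluded with q <= 4 / sqrt 7.  If e >= 1,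
   all new singular values are at most delta, which excludes the zero once more.
   For the condition number, the hypothesis on kappa forces e <= 11/20, and
   f(x)^2 >= 4 e (1 - e) >= (9/5) p: each step essentially replaces p by its
   square root, so 10^-8 becomes more than 1/10 of the upper bound for q after
   three steps. *)
From HB Require Import structures.
Require Import Defs.
From mathcomp Require Import all_boot all_order all_algebra.
From mathcomp Require Import complex.
From mathcomp Require Import boolp classical_sets reals.
From mathcomp Require Import ring lra.
Set Implicit Arguments.
Unset Strict Implicit.
Unset Printing Implicit Defensive.
Import Order.TTheory GRing.Theory Num.Theory.
Local Open Scope ring_scope.
Local Open Scope sesquilinear_scope.

(** * The scalar iteration *)

Section Iteration.
Variable R : realFieldType.
Implicit Types p q x e d c : R.

Definition step e x : R := (1 - e) * x + e / x.

Lemma stepE e x : 0 < x -> step e x * x = (1 - e) * x ^+ 2 + e.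
Proof. by move=> x0; rewrite /step; field; rewrite gt_eqF. Qed.

(** Multiplied by x, the value is (1 - e) x^2 + e, positive for e <= 1. For e > 1 this decreases in
    x, so x = q is the worst case; there it is immediate if q <= 1 and otherwise follows from e <= d
    p and the last hypothesis. *)
Lemma step_gt0 d p q e x : 0 < p -> p <= x <= q ->
  p <= e <= d * p -> d * p * (q ^+ 2 - 1) < q ^+ 2 -> 0 < step e x.
Proof.
move=> p0 /andP[px xq] /andP[pe edp] hw.
have x0 : 0 < x by lra.
rewrite -(pmulr_lgt0 _ x0) stepE //.
have [e1|e1] := lerP e 1; first by have := sqr_ge0 x; nra.
have xx : x ^+ 2 <= q ^+ 2 by rewrite lerXn2r ?nnegrE; lra.
have : (e - 1) * x ^+ 2 <= (e - 1) * q ^+ 2 by rewrite ler_pM2l //; lra.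
have [q1|q1] := lerP (q ^+ 2) 1; first by nra.
have : e * (q ^+ 2 - 1) <= d * p * (q ^+ 2 - 1) by rewrite ler_pM2r //; lra.
lra.
Qed.

Lemma step_max p q e x : 0 <= e <= 1 -> 0 < p -> p <= x <= q ->
  step e x <= Num.max (step e p) (step e q).
Proof.
move=> /andP[e0 e1] p0 /andP[px xq].
have x0 : 0 < x by lra.
have q0 : 0 < q by lra.
set M := Num.max _ _.
have hp : step e p <= M by rewrite le_max lexx.
have hq : step e q <= M by rewrite le_max lexx orbT.
have hp' : (1 - e) * p ^+ 2 + e <= M * p by rewrite -stepE // ler_pM2r.
have hq' : (1 - e) * q ^+ 2 + e <= M * q by rewrite -stepE // ler_pM2r.
rewrite -(ler_pM2r x0) stepE //.
have [pq|pq] := eqVneq p q.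
  by have -> : x = p by apply/eqP; rewrite eq_le; apply/andP; split; lra.
have qp : 0 < q - p by rewrite subr_gt0 lt_neqAle pq; lra.
rewrite -(ler_pM2r qp).
(* The quadratic (1 - e) X^2 - M X + e is convex and nonpositive at p and q. *)
have A1 : 0 <= (q - x) * (M * p - ((1 - e) * p ^+ 2 + e)) by apply: mulr_ge0; lra.
have A2 : 0 <= (x - p) * (M * q - ((1 - e) * q ^+ 2 + e)) by apply: mulr_ge0; lra.
have A3 : 0 <= (1 - e) * (q - x) * (x - p) * (q - p) by rewrite !mulr_ge0 //; lra.
rewrite -subr_ge0; apply: le_trans (addr_ge0 (addr_ge0 A1 A2) A3) _.
by rewrite le_eqVlt; apply/orP; left; apply/eqP; ring.
Qed.

(** For p <= 1 the value is nondecreasing in e, and at e = p it is 1 + p (1 - p). *)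
Lemma step_ge1 p e : 0 < p -> p <= 1 -> p <= e -> 1 <= step e p.
Proof.
move=> p0 p1 pe; rewrite -(ler_pM2r p0) stepE //.
have h1 : 0 <= (e - p) * (1 - p ^+ 2) by apply: mulr_ge0; nra.
have h2 : 0 <= p ^+ 2 * (1 - p) by apply: mulr_ge0; nra.
lra.
Qed.

(** Monotonicity in e again: the bound is the value at e = d p. *)
Lemma step_le_hi d p e : 0 < p -> p <= e <= d * p -> e <= 1 ->
  step e p <= p + d * (1 - p ^+ 2).
Proof.
move=> p0 /andP[pe ed] e1; rewrite -(ler_pM2r p0) stepE //.
have : 0 <= (d * p - e) * (1 - p ^+ 2) by apply: mulr_ge0; nra.
lra.
Qed.

(** For q >= 1 the value is nonincreasing in e, so e can be lowered to p. Convexity on [1, h] then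
    compares with the ends, where [step p 1] is 1. *)
Lemma step_le_end p q e h : 0 < p -> p <= e <= 1 -> 1 <= q <= h ->
  step e q <= Num.max 1 ((1 - p) * h + p / h).
Proof.
move=> p0 /andP[pe e1] /andP[q1 qh].
have q0 : 0 < q by lra.
have -> : (1 - p) * h + p / h = step p h by [].
have -> : 1 = step p 1 :> R by rewrite /step; lra.
apply: le_trans (step_max _ _ (_ : 1 <= q <= h)) => //; try lra.
rewrite -(ler_pM2r q0) !stepE //.
have h1 : 0 <= (e - p) * (q ^+ 2 - 1) by apply: mulr_ge0; nra.
lra.
Qed.

(** AM-GM for the summands (1 - e) x and e / x, whose product is e (1 - e). *)
Lemma step_amgm e x : 0 <= e <= 1 -> 0 < x -> 4 * e * (1 - e) <= step e x ^+ 2.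
Proof.
move=> /andP[e0 e1] x0; rewrite -subr_ge0.
have -> : step e x ^+ 2 - 4 * e * (1 - e) = ((1 - e) * x - e / x) ^+ 2.
  by rewrite /step; field; rewrite gt_eqF.
exact: sqr_ge0.
Qed.

(** For e >= 1 the linear term is nonpositive, and e / x <= d p / x <= d. *)
Lemma step_le_delta d p q e x : 0 < p -> p <= x <= q -> 1 <= e -> e <= d * p ->
  step e x <= d.
Proof.
move=> p0 /andP[px xq] e1 ed; have x0 : 0 < x by lra.
rewrite -(ler_pM2r x0) stepE //.
have : d * p <= d * x by rewrite ler_pM2l //; nra.
have := sqr_ge0 x; nra.
Qed.

(* [step e] vanishes only at the square root of e / (e - 1), and only if e > 1;
   the condition puts it above q for every e <= d p. *)
Definition zero_free d p q := d * p * (q ^+ 2 - 1) < q ^+ 2.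

(** Larger p or q only make the condition harder, so it can be tested on upper bounds: for d P <= 1
    it always holds, and for d P > 1 it reads (d P - 1) V^2 < d P. *)
Lemma zero_free_mono d p q P V : 0 <= d -> 0 <= p <= P -> 0 < q <= V ->
  d * P * (V ^+ 2 - 1) < V ^+ 2 -> zero_free d p q.
Proof.
move=> d0 /andP[p0 pP] /andP[q0 qV] h; rewrite /zero_free.
have [q1|q1] := lerP (q ^+ 2) 1.
  have : 0 <= d * p by apply: mulr_ge0. nra.
have qVs : q ^+ 2 <= V ^+ 2 by rewrite lerXn2r ?nnegrE; lra.
have dp : d * p <= d * P by rewrite ler_wpM2l.
have : d * p * (q ^+ 2 - 1) <= d * P * (q ^+ 2 - 1) by rewrite ler_pM2r //; lra.
have [h1|h1] := lerP (d * P) 1; first by nra.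
have : (d * P - 1) * q ^+ 2 <= (d * P - 1) * V ^+ 2 by rewrite ler_pM2l //; lra.
lra.
Qed.

(* Rational upper bounds: sqrt 7 / 2 <= dmax, and
   p + dmax (1 - p^2) <= dmax + 1 / (4 dmax) <= hmax. *)
Definition dmax : R := 127 / 96.
Definition hmax : R := 62 / 41.

(** As d p <= dmax q, it suffices that dmax (q^2 - 1) < q, and 36/25 lies just below the positive
    root of dmax (q^2 - 1) = q. *)
Lemma zero_free_small d p q : 0 <= d <= dmax -> 0 < p <= q -> q <= 36 / 25 ->
  zero_free d p q.
Proof.
rewrite /dmax /zero_free => /andP[d0 d1] /andP[p0 pq] q1.
have dp0 : 0 <= d * p by apply: mulr_ge0 => //; lra.
have q20 : 0 < q ^+ 2 by apply: exprn_gt0; lra.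
have [q2|q2] := lerP (q ^+ 2) 1; first by nra.
have dp : d * p <= (127 / 96) * q by apply: ler_pM => //; lra.
have h : d * p * (q ^+ 2 - 1) <= 127 / 96 * q * (q ^+ 2 - 1).
  by apply: ler_wpM2r => //; lra.
apply: le_lt_trans h _.
have q1' : 1 < q by nra.
(* On [1, 36/25] the square lies below its chord, which makes the inequality linear. *)
have h1 : 0 <= (q - 1) * (36 / 25 - q) by apply: mulr_ge0; lra.
have h2 : 0 < q * (q - 127 / 96 * (q ^+ 2 - 1)) by apply: mulr_gt0; lra.
lra.
Qed.

(** Here u and v stand for the new extremes: u is below the bounds for both end values, v below the
    larger bound. A large v restricts p, and this in turn bounds u. *)
Lemma zero_free_num d p u v : 0 <= d <= dmax -> 0 < p <= 1 -> 0 < u <= v ->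
  u <= p + dmax * (1 - p ^+ 2) ->
  u <= Num.max 1 ((1 - p) * hmax + p / hmax) ->
  v <= Num.max (p + dmax * (1 - p ^+ 2)) (Num.max 1 ((1 - p) * hmax + p / hmax)) ->
  zero_free d u v.
Proof.
move=> hd /andP[p0 p1] /andP[u0 uv] hu1 hu2 hv.
have [d0 d1] := andP hd.
(* The left side is affine in p, with slope 41/62 - 62/41 slightly below -17/20. *)
have hb : (1 - p) * hmax + p / hmax <= 62 / 41 - p * (17 / 20).
  by rewrite /hmax; lra.
have hu3 : u <= 1 \/ u <= 62 / 41 - p * (17 / 20).
  by move: hu2; rewrite le_max => /orP[h|h]; [left | right; exact: le_trans hb].
have hv3 : v <= p + dmax * (1 - p ^+ 2) \/ v <= 1 \/ v <= 62 / 41 - p * (17 / 20).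
  move: hv; rewrite !le_max => /or3P[h|h|h]; [by left| by right; left|].
  by right; right; exact: le_trans hb.
move=> {hu2 hv hb}.
have v0 : 0 < v by exact: lt_le_trans uv.
have [vs|vs] := lerP v (36 / 25).
  by apply: (zero_free_small hd) => //; rewrite u0.
(* Reduces each remaining case to one numeric inequality at a corner (P, V). *)
have num P V : u <= P -> v <= V ->
    dmax * P * (V ^+ 2 - 1) < V ^+ 2 -> zero_free d u v.
  move=> uP vV hn; have P0 : 0 <= P by apply: le_trans uP; exact: ltW.
  have V1 : 1 <= V ^+ 2 by move: (vs) (vV); clear; nra.
  apply: (zero_free_mono d0 (P := P) (V := V)); rewrite ?u0 ?v0 ?(ltW u0) //.
  apply: le_lt_trans hn; apply: ler_wpM2r; first by rewrite subr_ge0.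
  exact: ler_wpM2r.
move=> {hd d0 d1}.
rewrite /dmax in hu1 hv3 num.
have hu4 : u <= p + 127 / 96 by have := sqr_ge0 p; lra.
(* The pieces in p and v are chosen so that the bounds for u and v at their
   endpoints meet the numeric inequality of [num]. *)
case: hv3 => [hv3|[|hv3]]; last 1 first.
- move=> {hu1 hu3}.
  have [c1|c1] := lerP p (1/60); first by apply: (num (127/96 + 1/60) (62/41)); lra.
  have [c2|c2] := lerP p (1/30).
    by apply: (num (127/96 + 1/30) (62/41-17/1200)); lra.
  have [c3|c3] := lerP p (1/20).
    by apply: (num (127/96 + 1/20) (62/41-17/600)); lra.
  have [c4|c4] := lerP p (1/13).
    by apply: (num (127/96 + 1/13) (62/41-17/400)); lra.
  (* Here p < 1/11, because v > 36/25. *)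
  by apply: (num (127/96 + 1/11) (62/41-17/260)); lra.
(* The bound p + dmax (1 - p^2) is below 36/25 for p <= 1/7 and below 59/40 for p <= 1/5, so such p
   contradict the lower bounds on v. *)
- have [c1|c1] := lerP p (1/7); first by nra.
  have [c2|c2] := lerP v (59/40).
    by apply: (num (62/41-17/140) (59/40)); lra.
  have [c3|c3] := lerP p (1/5); first by nra.
  (* The parabola p + dmax (1 - p^2) has its vertex at 1 / (2 dmax) = 48/127. *)
  have vh : v <= 62/41 by have := sqr_ge0 (p - 48/127); lra.
  by apply: (num (62/41-17/100) (62/41)); lra.
- by lra.
Qed.

End Iteration.

(** * Evolution of the extreme singular values over one and three steps *)

Section ExtremeIteration.
Variable R : realFieldType.
Implicit Types a b c d e p q t : R.

(** All that the scalar argument needs to know about a matrix step, with extreme singular values p,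
    q before and p', q' after. Only p and q are known to occur among the old singular values; the
    others merely lie between them. *)
Definition step_bounds e p q p' q' : Prop :=
  [/\ 0 < p' <= q',
      forall x, x = p \/ x = q -> p' <= step e x <= q',
      forall h, (forall x, p <= x <= q -> step e x <= h) -> q' <= h &
      forall l, (forall x, p <= x <= q -> l <= step e x ^+ 2) -> l <= p' ^+ 2].

(** The image of p keeps q' at least 1, and by convexity q' is at most the larger end value. As p'
    is at most both end values, [zero_free_num] applies. *)
Lemma step_bounds_le1 d e p q p' q' : 0 <= d <= dmax R -> 0 < p ->
  p <= e <= d * p -> e <= 1 -> 1 <= q <= hmax R ->
  step_bounds e p q p' q' -> 1 <= q' <= hmax R /\ zero_free d p' q'.
Proof.
move=> hd p0 hpe e1 hq [p'0 pq' hle _].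
have [/andP[d0 d1] /andP[pe edp]] := (hd, hpe).
have p1 : p <= 1 by exact: le_trans e1.
have := pq' p (or_introl erefl) => /andP[p'p q'p].
have := pq' q (or_intror erefl) => /andP[p'q _].
have sp : step e p <= p + dmax R * (1 - p ^+ 2).
  apply: le_trans (step_le_hi p0 hpe e1) _; rewrite lerD2l.
  by apply: ler_wpM2r => //; rewrite subr_ge0 expr_le1 // ltW.
have sq : step e q <= Num.max 1 ((1 - p) * hmax R + p / hmax R).
  by apply: step_le_end => //; rewrite pe.
have q'max : q' <= Num.max (step e p) (step e q).
  apply: hle => x px; apply: step_max => //.
  by rewrite e1 andbT ltW // (lt_le_trans p0).
have q'num : q' <= Num.max (p + dmax R * (1 - p ^+ 2))
                        (Num.max 1 ((1 - p) * hmax R + p / hmax R)).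
  apply: le_trans q'max _; rewrite ge_max !le_max sp /=.
  by move: sq; rewrite le_max => ->; rewrite orbT.
split; last first.
  apply: zero_free_num q'num => //; try exact: le_trans sp || exact: le_trans sq.
  by rewrite p0.
rewrite (le_trans (step_ge1 p0 p1 pe) q'p) /=; apply: le_trans q'num _.
rewrite !ge_max /dmax /hmax; have := sqr_ge0 (p - 48 / 127).
by move=> h; apply/and3P; split; lra.
Qed.

(** For e >= 1 all new values are at most d <= dmax < 36/25, the range of [zero_free_small]. *)
Lemma step_bounds_ge1 d e p q p' q' : 0 <= d <= dmax R -> 0 < p ->
  e <= d * p -> 1 <= e -> step_bounds e p q p' q' ->
  q' <= dmax R /\ zero_free d p' q'.
Proof.
move=> hd p0 edp e1 [p'0 _ hle _]; have [_ d1] := andP hd.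
have q'd : q' <= dmax R.
  by apply: le_trans d1; apply: hle => x px; apply: (step_le_delta p0 px).
split=> //; apply: zero_free_small => //; apply: le_trans q'd _.
by rewrite /dmax; lra.
Qed.

(** Since 1 - e >= 9/20, the AM-GM bound 4 e (1 - e) is at least (9/5) e >= (9/5) p. *)
Lemma step_bounds_min_sqr_ge e p q p' q' : 0 < p -> p <= e <= 11 / 20 ->
  step_bounds e p q p' q' -> 9 / 5 * p <= p' ^+ 2.
Proof.
move=> p0 /andP[pe e1] [_ _ _ lo].
apply: (@le_trans _ _ (4 * e * (1 - e))); first by nra.
apply: lo => x /andP[px _]; apply: step_amgm; first by apply/andP; split; lra.
exact: lt_le_trans px.
Qed.

(** [r2] stands for sqrt 2. The ratio bound gives (14/5) d p < q <= 62/41, hence e <= d p <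
    11/20. *)
Lemma eps_le_of_ratio d e p q : 1 <= d -> 0 < p -> q <= hmax R ->
  forall r2, 7 / 5 <= r2 -> e <= d * p -> 2 * r2 * d < q / p -> e <= 11 / 20.
Proof.
move=> d1 p0 qh r2 hr ed; rewrite ltr_pdivlMr // => hk.
have dp : 0 < d * p by apply: mulr_gt0 => //; lra.
have : 14 / 5 * (d * p) <= 2 * r2 * d * p.
  by rewrite -[leRHS]mulrA; apply: ler_wpM2r; lra.
move: qh; rewrite /hmax; lra.
Qed.

Lemma le_of_sqr_le a b c : 0 <= a -> 0 <= b -> c <= a ^+ 2 -> b ^+ 2 <= c -> b <= a.
Proof.
move=> a0 b0 ca bc; rewrite -(@ler_pXn2r _ 2) ?nnegrE //.
exact: le_trans ca.
Qed.

(** Starting from p0 >= t^8, repeated square roots of (9/5) p, with factors rounded down to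
    rationals, give the lower bounds (4/3) t^4, (3/2) t^2 and (8/5) t. The last factor exceeds
    [hmax]. *)
Lemma ratio_after_three_steps p0 p1 p2 p3 q0 q3 t : 0 < t ->
  0 < p0 -> 0 < p1 -> 0 < p2 -> 0 < p3 -> 1 <= q0 -> q3 <= hmax R ->
  9 / 5 * p0 <= p1 ^+ 2 -> 9 / 5 * p1 <= p2 ^+ 2 -> 9 / 5 * p2 <= p3 ^+ 2 ->
  q0 / p0 < (t ^+ 8)^-1 -> q3 / p3 < t^-1.
Proof.
move=> t0 h0 h1 h2 h3 q01 q3h a1 a2 a3 hk.
have t2 : 0 < t ^+ 2 by apply: exprn_gt0.
have t4 : 0 < t ^+ 4 by apply: exprn_gt0.
have t8 : 0 < t ^+ 8 by apply: exprn_gt0.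
have b0 : t ^+ 8 <= p0.
  move: hk; rewrite ltr_pdivrMr // mulrC ltr_pdivlMr // => hk; nra.
have b1 : 4 / 3 * t ^+ 4 <= p1.
  apply: le_of_sqr_le a1 _; [exact: ltW | by lra |].
  by rewrite exprMn -exprM; lra.
have b2 : 3 / 2 * t ^+ 2 <= p2.
  apply: le_of_sqr_le a2 _; [exact: ltW | by lra |].
  by rewrite exprMn -exprM; lra.
have b3 : 8 / 5 * t <= p3.
  apply: le_of_sqr_le a3 _; [exact: ltW | by lra |].
  by rewrite exprMn; lra.
rewrite ltr_pdivrMr // mulrC ltr_pdivlMr //.
have : q3 * t <= hmax R * t by rewrite ler_pM2r.
by rewrite /hmax; lra.
Qed.

End ExtremeIteration.

(** * Quaternion matrices and vector norms *)

Section QuaternionNorm.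
Variable R : rcfType.
Implicit Types (x y : quat R) (a b : R[i]) (r : R).

(** Squared modulus taken in R, so that it can be compared with singular values. *)
Definition nsqc a : R := complex.Re a ^+ 2 + complex.Im a ^+ 2.
Definition nsqq x : R := nsqc (quat0 x) + nsqc (quat1 x).

Lemma quatP x y : quat0 x = quat0 y -> quat1 x = quat1 y -> x = y.
Proof. by case: x y => [a b] [c d] /= -> ->. Qed.

Lemma quat0M x y : quat0 (x * y) = quat0 x * quat0 y - quat1 x * (quat1 y)^*.
Proof. by []. Qed.
Lemma quat1M x y : quat1 (x * y) = quat0 x * quat1 y + quat1 x * (quat0 y)^*.
Proof. by []. Qed.

Lemma quat0_is_zmod_morphism : zmod_morphism (@quat0 R). Proof. by []. Qed.
HB.instance Definition _ :=
  GRing.isZmodMorphism.Build (quat R) R[i] (@quat0 R) quat0_is_zmod_morphism.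
Lemma quat1_is_zmod_morphism : zmod_morphism (@quat1 R). Proof. by []. Qed.
HB.instance Definition _ :=
  GRing.isZmodMorphism.Build (quat R) R[i] (@quat1 R) quat1_is_zmod_morphism.

Lemma conj_real_complex r : (r%:C%C : R[i])^* = r%:C%C.
Proof. exact: conjc_real. Qed.

Lemma mulc_conj a : a * a^* = (nsqc a)%:C%C.
Proof.
by case: a => a b; rewrite /nsqc /=; simpc; congr Complex; ring.
Qed.

Lemma nsqc_ge0 a : 0 <= nsqc a.
Proof. by rewrite addr_ge0 ?sqr_ge0. Qed.

Lemma nsqc_eq0 a : (nsqc a == 0) = (a == 0).
Proof.
case: a => a b; rewrite /nsqc paddr_eq0 ?sqr_ge0 //= !sqrf_eq0.
by rewrite eq_complex.
Qed.

Lemma nsqcN a : nsqc (- a) = nsqc a.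
Proof. by case: a => a b; rewrite /nsqc /= !sqrrN. Qed.

Lemma nsqc_conj a : nsqc a^* = nsqc a.
Proof. by case: a => a b; rewrite /nsqc /= sqrrN. Qed.

Lemma nsqc0 : nsqc 0 = 0. Proof. by apply/eqP; rewrite nsqc_eq0. Qed.

Lemma nsqq_ge0 x : 0 <= nsqq x.
Proof. by rewrite addr_ge0 ?nsqc_ge0. Qed.

Lemma nsqq_eq0 x : (nsqq x == 0) = (x == 0).
Proof.
rewrite /nsqq paddr_eq0 ?nsqc_ge0 // !nsqc_eq0.
by apply/andP/eqP => [[/eqP ? /eqP ?]|->] //; apply: quatP.
Qed.

Lemma conjqK : involutive (@conjq R).
Proof. by move=> [a b]; rewrite /conjq /= conjCK opprK. Qed.

Lemma conjq_is_zmod_morphism : zmod_morphism (@conjq R).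
Proof.
move=> x y; apply: quatP; rewrite /= ?(raddfB (@quat0 R), raddfB (@quat1 R)) /=.
  by rewrite rmorphB.
by rewrite opprB opprK addrC.
Qed.
HB.instance Definition _ :=
  GRing.isZmodMorphism.Build (quat R) (quat R) (@conjq R) conjq_is_zmod_morphism.

Lemma conjqM x y : conjq (x * y) = conjq y * conjq x.
Proof.
case: x y => [a b] [c d]; apply: quatP; rewrite !(quat0M, quat1M) /=.
  by rewrite ?(rmorphB, rmorphN, rmorphM, conjCK) /= ?(rmorphM, conjCK); ring.
by rewrite conjCK; ring.
Qed.

Lemma qreal_is_zmod_morphism : zmod_morphism (@qreal R).
Proof.
move=> a b; apply: quatP; rewrite ?(raddfB (@quat0 R), raddfB (@quat1 R)) /=.
  by rewrite rmorphB.
by rewrite subrr.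
Qed.
HB.instance Definition _ :=
  GRing.isZmodMorphism.Build R (quat R) (@qreal R) qreal_is_zmod_morphism.
Lemma qreal_is_monoid_morphism : monoid_morphism (@qreal R).
Proof.
split=> // a b; apply: quatP; rewrite !(quat0M, quat1M) /= ?rmorph0.
  by rewrite rmorphM; ring.
by ring.
Qed.
HB.instance Definition _ :=
  GRing.isMonoidMorphism.Build R (quat R) (@qreal R) qreal_is_monoid_morphism.

Lemma qreal_comm r x : qreal r * x = x * qreal r.
Proof.
by apply: quatP; rewrite !(quat0M, quat1M) /= ?rmorph0 ?conj_real_complex; ring.
Qed.

Lemma qreal_inj : injective (@qreal R).
Proof. by move=> a b [] . Qed.

Lemma conjq_qreal r : conjq (qreal r) = qreal r.
Proof. by apply: quatP; rewrite /= ?oppr0 ?conj_real_complex. Qed.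

Lemma mulq_conj x : x * conjq x = qreal (nsqq x).
(* The rewriting uses the earlier componentwise formula of the same name. *)
Proof. by rewrite mulq_conj !mulc_conj -rmorphD. Qed.

Lemma mulq_conjl x : conjq x * x = qreal (nsqq x).
Proof.
rewrite -{2}[x]conjqK mulq_conj; congr qreal.
by rewrite /nsqq /= nsqc_conj nsqcN.
Qed.

End QuaternionNorm.

Section QuaternionMatrixNorm.
Variable R : realType.
Local Notation Q := (quat R).

Lemma conjtrqK m n (A : 'M[Q]_(m, n)) : conjtrq (conjtrq A) = A.
Proof. by apply/matrixP => i j; rewrite !mxE conjqK. Qed.

Lemma conjtrqM m n p (A : 'M[Q]_(m, n)) (B : 'M[Q]_(n, p)) :
  conjtrq (A *m B) = conjtrq B *m conjtrq A.
Proof.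
apply/matrixP => i j; rewrite !mxE raddf_sum /=; apply: eq_bigr => k _.
by rewrite !mxE conjqM.
Qed.

Lemma conjtrqB m n (A B : 'M[Q]_(m, n)) :
  conjtrq (A - B) = conjtrq A - conjtrq B.
Proof. by apply/matrixP => i j; rewrite !mxE raddfB. Qed.

Lemma conjtrqZ m n r (A : 'M[Q]_(m, n)) :
  conjtrq (qreal r *: A) = qreal r *: conjtrq A.
Proof.
by apply/matrixP => i j; rewrite !mxE conjqM conjq_qreal qreal_comm.
Qed.

Lemma conjtrq_scalar n (a : Q) : conjtrq (a%:M : 'M_n) = (conjq a)%:M.
Proof.
apply/matrixP => i j; rewrite !mxE eq_sym.
by case: eqP => _; rewrite ?mulr1n // !mulr0n raddf0.
Qed.

Lemma conjtrq1 n : conjtrq (1%:M : 'M[Q]_n) = 1%:M.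
Proof. by rewrite conjtrq_scalar -(rmorph1 (@qreal R)) conjq_qreal. Qed.

Lemma conjtrq0 m n : conjtrq (0 : 'M[Q]_(m, n)) = 0.
Proof. by apply/matrixP => i j; rewrite !mxE raddf0. Qed.

Lemma conjtrq_block m1 m2 n1 n2 (A : 'M[Q]_(m1, n1)) (B : 'M_(m1, n2))
    (C : 'M_(m2, n1)) (D : 'M_(m2, n2)) :
  conjtrq (block_mx A B C D) =
  block_mx (conjtrq A) (conjtrq C) (conjtrq B) (conjtrq D).
Proof. by rewrite /conjtrq map_block_mx tr_block_mx. Qed.

(** Scaling acts from the left; it passes through A because real quaternions are central. *)
Lemma mulmxZq m n p r (A : 'M[Q]_(m, n)) (B : 'M[Q]_(n, p)) :
  A *m (qreal r *: B) = qreal r *: (A *m B).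
Proof.
apply/matrixP => i j; rewrite !mxE mulr_sumr; apply: eq_bigr => k _.
by rewrite !mxE !mulrA qreal_comm.
Qed.

Lemma unitaryqM n (U V : 'M[Q]_n) :
  unitaryq U -> unitaryq V -> unitaryq (U *m V).
Proof.
move=> [U1 U2] [V1 V2]; split; rewrite conjtrqM !mulmxA.
  by rewrite -(mulmxA _ _ U) U1 mulmx1.
by rewrite -(mulmxA _ V) V2 mulmx1.
Qed.

Lemma unitaryq1 n : unitaryq (1%:M : 'M[Q]_n).
Proof. by split; rewrite conjtrq1 mulmx1. Qed.

Definition vnsq n (x : 'cV[Q]_n) : R := \sum_i nsqq (x i 0).

Lemma vnsq_ge0 n (x : 'cV[Q]_n) : 0 <= vnsq x.
Proof. by apply: sumr_ge0 => i _; exact: nsqq_ge0. Qed.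

Lemma vnsq_eq0 n (x : 'cV[Q]_n) : (vnsq x == 0) = (x == 0).
Proof.
apply/eqP/eqP => [h|->]; last first.
  by rewrite /vnsq big1 // => i _; apply/eqP; rewrite mxE nsqq_eq0.
apply/matrixP => i j; rewrite ord1 mxE; apply/eqP.
move/eqP: h; rewrite /vnsq psumr_eq0 => [/allP /(_ i)|k _]; last exact: nsqq_ge0.
by rewrite mem_index_enum nsqq_eq0 => /(_ isT).
Qed.

Lemma vnsq0 n : vnsq (0 : 'cV[Q]_n) = 0.
Proof. by apply/eqP; rewrite vnsq_eq0. Qed.

Lemma conjtrq_mulmx_vnsq n (x : 'cV[Q]_n) :
  conjtrq x *m x = (qreal (vnsq x))%:M.
Proof.
apply/matrixP => i j; rewrite !ord1 !mxE rmorph_sum mulr1n /=.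
by apply: eq_bigr => k _; rewrite !mxE mulq_conjl.
Qed.

(** Norms are computed below as the single entry of x^* x, which turns them into matrix algebra. *)
Lemma vnsqP n (x : 'cV[Q]_n) r :
  (conjtrq x *m x) 0 0 = qreal r -> vnsq x = r.
Proof. by rewrite conjtrq_mulmx_vnsq mxE mulr1n => /qreal_inj. Qed.

Lemma vnsq_mul_unitary m n (U : 'M[Q]_(m, n)) (x : 'cV[Q]_n) :
  conjtrq U *m U = 1%:M -> vnsq (U *m x) = vnsq x.
Proof.
move=> hU; apply: vnsqP.
by rewrite conjtrqM mulmxA -(mulmxA _ _ U) hU mulmx1 conjtrq_mulmx_vnsq mxE mulr1n.
Qed.

Lemma vnsq_mulr n (x : 'cV[Q]_n) a : vnsq (x *m a%:M) = vnsq x * nsqq a.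
Proof.
apply: vnsqP; rewrite conjtrqM mulmxA -(mulmxA _ _ x) conjtrq_mulmx_vnsq.
rewrite conjtrq_scalar -!scalar_mxM mxE mulr1n.
by rewrite -qreal_comm -mulrA mulq_conjl -rmorphM.
Qed.

Lemma vnsqZ n (x : 'cV[Q]_n) r : vnsq (qreal r *: x) = r ^+ 2 * vnsq x.
Proof.
apply: vnsqP; rewrite conjtrqZ -scalemxAl mulmxZq conjtrq_mulmx_vnsq.
by rewrite !mxE mulr1n expr2 -mulrA !rmorphM.
Qed.

Lemma vnsq_col_mx m n (x : 'cV[Q]_m) (y : 'cV[Q]_n) :
  vnsq (col_mx x y) = vnsq x + vnsq y.
Proof.
rewrite /vnsq big_split_ord /=.
by congr (_ + _); apply: eq_bigr => i _; rewrite ?col_mxEu ?col_mxEd.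
Qed.

Lemma vnsq_delta n (j : 'I_n) : vnsq (delta_mx j 0) = 1.
Proof.
rewrite /vnsq (bigD1 j) //= big1 ?addr0 => [|i /negPf ij].
  by rewrite mxE !eqxx /nsqq /nsqc /=; ring.
by apply/eqP; rewrite mxE ij nsqq_eq0.
Qed.

Lemma mulmx_all_eq0 m1 n (A : 'M[Q]_(m1, n)) :
  (forall x : 'cV_n, A *m x = 0) -> A = 0.
Proof.
move=> h; apply/matrixP => i j; have /matrixP/(_ i 0) := h (delta_mx j 0).
by rewrite -colE !mxE.
Qed.

(** The middle factor in [is_singvalsq]; its entries come from a sequence, so that the shape can
    vary. *)
Definition diagq m n (d : nat -> R) : 'M[Q]_(m, n) :=
  \matrix_(i, j) (qreal (d i) *+ (i == j :> nat)).

Lemma conjtrq_diag m n d : conjtrq (diagq m n d) = diagq n m d.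
Proof.
apply/matrixP => i j; rewrite !mxE eq_sym.
by case: eqP => [->|_]; rewrite ?mulr1n ?conjq_qreal // !mulr0n raddf0.
Qed.

(** The inner dimension n truncates the product: entries from index n on vanish. *)
Lemma diagq_mul m n p d e :
  diagq m n d *m diagq n p e = diagq m p (fun i => d i * e i *+ (i < n)%N).
Proof.
apply/matrixP => i j; rewrite !mxE.
have [lt_in|le_ni] := ltnP i n.
  rewrite (bigD1 (Ordinal lt_in)) //= big1 ?addr0 => [|k /negPf ki]; last first.
    rewrite !mxE; suff -> : (i == k :> nat) = false by rewrite mulr0n mul0r.
    by rewrite eq_sym; apply: contraFF ki => /eqP ki; apply/eqP/val_inj.
  by rewrite !mxE /= eqxx !mulr1n rmorphM -mulrnAr.
rewrite big1 ?rmorph0 ?mul0rn // => k _; rewrite !mxE.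
by rewrite gtn_eqF ?mulr0n ?mul0r // (leq_trans (ltn_ord k)).
Qed.

Lemma eq_diagq m n d e : (forall i, (i < minn m n)%N -> d i = e i) ->
  diagq m n d = diagq m n e.
Proof.
move=> h; apply/matrixP => i j; rewrite !mxE; case: eqP => // ij.
by rewrite h // leq_min ltn_ord ij ltn_ord.
Qed.

Lemma diagq1 n : diagq n n (fun=> 1) = 1%:M.
Proof. by apply/matrixP => i j; rewrite !mxE rmorph1. Qed.

Lemma vnsq_diag_mul m n d (x : 'cV[Q]_n) : (n <= m)%N ->
  vnsq (diagq m n d *m x) = \sum_(i < n) d i ^+ 2 * nsqq (x i 0).
Proof.
move=> nm; apply: vnsqP.
rewrite conjtrqM conjtrq_diag mulmxA -(mulmxA _ _ (diagq _ _ _)).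
rewrite diagq_mul -mulmxA mxE rmorph_sum /=; apply: eq_bigr => i _.
rewrite !mxE (bigD1 i) //= big1 ?addr0 => [|k /negPf ki]; last first.
  by rewrite mxE eq_sym val_eqE ki mulr0n mul0r.
rewrite !mxE eqxx (leq_trans (ltn_ord i) nm) !mulr1n mulrA -qreal_comm -mulrA.
by rewrite mulq_conjl -rmorphM expr2.
Qed.

End QuaternionMatrixNorm.

(** * Existence of singular value decompositions *)

Section Reflection.
Variable R : realType.
Local Notation Q := (quat R).

(* The Householder reflection in the hyperplane orthogonal to y - x. *)
Lemma unitary_reflection n (x y : 'cV[Q]_n) r :
  vnsq x = 1 -> vnsq y = 1 -> conjtrq y *m x = (qreal r)%:M ->
  exists2 U : 'M[Q]_n, unitaryq U & U *m x = y.
Proof.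
move=> x1 y1 yx.
have xy : conjtrq x *m y = (qreal r)%:M.
  by rewrite -(conjtrqK y) -conjtrqM yx conjtrq_scalar conjq_qreal.
set w := y - x.
have ww : conjtrq w *m w = (qreal (2 * (1 - r)))%:M.
  rewrite /w conjtrqB mulmxBl !mulmxBr !conjtrq_mulmx_vnsq x1 y1 xy yx.
  by rewrite -!raddfB /=; congr (qreal _)%:M; ring.
have wx : conjtrq w *m x = (qreal (r - 1))%:M.
  by rewrite /w conjtrqB mulmxBl yx conjtrq_mulmx_vnsq x1 -!raddfB.
(* For r = 1 the norm |w|^2 = 2 (1 - r) vanishes, so x = y. *)
have [r1|r1] := eqVneq r 1.
  exists 1%:M; first exact: unitaryq1.
  apply/esym/eqP; rewrite mul1mx -subr_eq0 -vnsq_eq0; apply/eqP/vnsqP.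
  by rewrite ww mxE mulr1n r1; congr qreal; ring.
have r10 : 1 - r != 0 by rewrite subr_eq0 eq_sym.
(* This is 2 / |w|^2, the coefficient of the reflection. *)
pose c := (1 - r)^-1.
pose H : 'M[Q]_n := 1%:M - qreal c *: (w *m conjtrq w).
have Hs : conjtrq H = H.
  by rewrite /H conjtrqB conjtrq1 conjtrqZ conjtrqM conjtrqK.
have HH : H *m H = 1%:M.
  rewrite /H mulmxBl mul1mx mulmxBr mulmx1 -scalemxAl mulmxZq.
  rewrite mulmxA -(mulmxA w) ww -(mulmxA w) mul_scalar_mx mulmxZq.
  rewrite !scalerA -!rmorphM -scalerBl -raddfB -addrA -opprD -scalerDl -raddfD.
  rewrite /c (_ : _ + _ = 0) ?raddf0 ?scale0r ?subr0 //; field.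
  exact: r10.
exists H; first by split; rewrite Hs.
(* As c (r - 1) = -1, the image of x is x + w = y. *)
rewrite /H mulmxBl mul1mx -scalemxAl -mulmxA wx.
have -> : w *m (qreal (r - 1))%:M = qreal (r - 1) *: w.
  by rewrite -scalemx1 mulmxZq mulmx1.
rewrite scalerA -rmorphM (_ : _ * _ = -1); last by rewrite /c; field.
by rewrite rmorphN1 scaleN1r opprK addrC /w subrK.
Qed.

Lemma unitary_with_col n (v : 'cV[Q]_n.+1) : vnsq v = 1 ->
  exists2 U : 'M[Q]_n.+1, unitaryq U & U *m delta_mx 0 0 = v.
Proof.
move=> v1; pose a := v 0 0.
(* The reflection needs a real inner product: replace e_0 by e_0 b. *)
have [b nb [r ar]] : exists2 b : Q, nsqq b = 1 & exists r, conjq a * b = qreal r.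
  have [a0|a0] := eqVneq a 0.
    exists 1; first by rewrite /nsqq /nsqc /=; ring.
    by exists 0; rewrite a0 raddf0 mul0r rmorph0.
  have na : 0 < nsqq a by rewrite lt_neqAle nsqq_ge0 eq_sym nsqq_eq0 a0.
  (* The choice b = a / |a| makes the product equal to |a|. *)
  exists (a * qreal (Num.sqrt (nsqq a))^-1).
    apply: (@qreal_inj R); rewrite -mulq_conjl conjqM conjq_qreal mulrA.
    rewrite -(mulrA _ (conjq a)) mulq_conjl -!rmorphM; congr qreal.
    by rewrite -[X in _ * X * _]sqr_sqrtr ?ltW //; field; rewrite gt_eqF ?sqrtr_gt0.
  by exists (nsqq a * (Num.sqrt (nsqq a))^-1); rewrite mulrA mulq_conjl -rmorphM.
have vb : vnsq (delta_mx 0 0 *m b%:M : 'cV[Q]_n.+1) = 1.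
  by rewrite vnsq_mulr vnsq_delta mul1r.
have [|U Uu Ue] := @unitary_reflection _ _ _ r vb v1.
  rewrite mulmxA; apply/matrixP => i j; rewrite !ord1 -colE.
  by rewrite !mxE big_ord1 !mxE !mulr1n ar.
(* Since |b| = 1, the scalar matrix of b is unitary, and U absorbs it. *)
exists (U *m b%:M).
  apply: unitaryqM => //; split; rewrite conjtrq_scalar -scalar_mxM.
    by rewrite mulq_conjl nb rmorph1.
  by rewrite mulq_conj nb rmorph1.
rewrite -mulmxA -[RHS]Ue; congr (_ *m _); apply/matrixP => i j.
rewrite !ord1 mul_scalar_mx !mxE big_ord1 !mxE.
by case: (i == 0); rewrite /= ?mulr1 ?mulr0 ?mul1r ?mul0r.
Qed.

End Reflection.

(** * The complex adjoint of a quaternion matrix *)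

Section ComplexAdjoint.
Variable R : realType.
Local Notation Q := (quat R).
Local Notation C := R[i].

(** The usual embedding into complex matrices of twice the size; its first block column is
    [compact A]. *)
Definition adjc m n (A : 'M[Q]_(m, n)) : 'M[C]_(m + m, n + n) :=
  block_mx (map_mx (@quat0 R) A) (map_mx (@quat1 R) A)
           (- map_mx (fun x : Q => (quat1 x)^*) A)
           (map_mx (fun x : Q => (quat0 x)^*) A).

Lemma compact_mul m n p (A : 'M[Q]_(m, n)) (B : 'M[Q]_(n, p)) :
  compact (A *m B) = adjc A *m compact B.
Proof.
rewrite /compact /adjc mul_block_col; congr col_mx; apply/matrixP => i j.
  rewrite !mxE raddf_sum -big_split /=; apply: eq_bigr => k _.
  by rewrite !mxE mulrN.
rewrite !mxE raddf_sum /= rmorph_sum -sumrN -big_split /=; apply: eq_bigr => k _.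
by rewrite !mxE rmorphD !rmorphM /= conjCK; ring.
Qed.

Lemma adjc_conjtr m n (A : 'M[Q]_(m, n)) : adjc (conjtrq A) = (adjc A) ^t*.
Proof.
rewrite /adjc tr_block_mx map_block_mx; congr block_mx;
  apply/matrixP => i j; rewrite !mxE //= ?rmorphN /= ?conjCK ?opprK //.
Qed.

Definition uncompact m n (M : 'M[C]_(m + m, n)) : 'M[Q]_(m, n) :=
  \matrix_(i, j) Quat (usubmx M i j) (- (dsubmx M i j)^*).

Lemma compactK m n : cancel (@compact R m n) (@uncompact m n).
Proof.
move=> A; apply/matrixP => i j; rewrite /compact /uncompact mxE col_mxKu col_mxKd.
by rewrite !mxE rmorphN /= conjCK opprK; case: (A i j).
Qed.

Lemma uncompactK m n : cancel (@uncompact m n) (@compact R m n).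
Proof.
move=> M; rewrite -[RHS]vsubmxK; congr col_mx; apply/matrixP => i j.
  by rewrite !mxE.
by rewrite !mxE /= rmorphN /= conjCK opprK.
Qed.

Lemma compactZ m n r (A : 'M[Q]_(m, n)) :
  compact (qreal r *: A) = r%:C%C *: compact A.
Proof.
rewrite /compact scale_col_mx; congr col_mx; apply/matrixP => i j; rewrite !mxE.
  by rewrite quat0M mul0r subr0.
by rewrite quat1M /= mul0r addr0 rmorphM /= conj_real_complex mulrN.
Qed.

Lemma vnsq_compact n (x : 'cV[Q]_n) :
  (compact x) ^t* *m compact x = ((vnsq x)%:C%C)%:M.
Proof.
rewrite /compact tr_col_mx map_row_mx mul_row_col; apply/matrixP => i j.
rewrite !ord1 !mxE mulr1n /vnsq rmorph_sum -big_split /=; apply: eq_bigr => k _.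
rewrite !mxE /nsqq rmorphD /= -!mulc_conj rmorphN /= conjCK mulrNN.
by rewrite mulrC.
Qed.

(* The Gram matrix is diagonalised through its complex adjoint. *)
Lemma max_gain_vector m n (A : 'M[Q]_(m, n.+1)) :
  exists (l : R) (v : 'cV[Q]_n.+1),
  [/\ vnsq v = 1, conjtrq A *m A *m v = qreal l *: v &
      forall x, vnsq (A *m x) <= l * vnsq x].
Proof.
pose G := adjc (conjtrq A *m A).
have Gs : G ^t* = G by rewrite /G -adjc_conjtr conjtrqM conjtrqK.
(* Being Hermitian, G is unitarily diagonalisable: G = P^* diag(d) P. *)
have /orthomx_spectralP : G \is normalmx by apply/normalmxP; rewrite Gs.
set P := spectralmx G; set d := spectral_diag G => GE.
have Pu : P \is unitarymx := spectral_unitarymx G.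
rewrite invmx_unitary // in GE.
have PP : P *m P ^t* = 1%:M by apply/unitarymxP.
have PP' : P ^t* *m P = 1%:M by apply: mulmx1C.
have vP x : vnsq x = \sum_i nsqc ((P *m compact x) i 0).
  apply: complexI; rewrite [RHS]rmorph_sum /=.
  transitivity (((P *m compact x) ^t* *m (P *m compact x)) 0 0).
    rewrite trmx_mul map_mxM mulmxA -(mulmxA _ _ P) PP' mulmx1.
    by rewrite vnsq_compact mxE mulr1n.
  by rewrite mxE; apply: eq_bigr => i _; rewrite !mxE mulrC mulc_conj.
(* In the coordinates of P, the form x^* A^* A x is a sum of squared moduli weighted by the
   eigenvalues. *)
have vA x : (vnsq (A *m x))%:C%C = \sum_i d 0 i * (nsqc ((P *m compact x) i 0))%:C%C.
  transitivity (((compact x) ^t* *m G *m compact x) 0 0).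
    rewrite -mulmxA -compact_mul -mulmxA compact_mul adjc_conjtr mulmxA.
    by rewrite -map_mxM -trmx_mul -compact_mul vnsq_compact mxE mulr1n.
  rewrite GE !mulmxA -map_mxM -trmx_mul -!mulmxA mulmxA mul_mx_diag mxE.
  by apply: eq_bigr => i _; rewrite !mxE -mulc_conj; ring.
(* Since [compact] is onto, every complex eigenvector comes from a quaternion vector. *)
have [w Pw] : exists w : 'I_(n.+1 + n.+1) -> 'cV[Q]_n.+1,
    forall i, P *m compact (w i) = delta_mx i 0.
  exists (fun i => uncompact (P ^t* *m delta_mx i 0)) => i.
  by rewrite uncompactK mulmxA PP mul1mx.
pose l i := vnsq (A *m w i).
(* An eigenvalue is the squared gain of its unit eigenvector, hence real, so a largest one can be
   chosen in R. *)
have dl i : d 0 i = (l i)%:C%C.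
  rewrite /l vA Pw (bigD1 i) //= big1 ?addr0 => [|k /negPf ki].
    by rewrite mxE !eqxx /nsqc /= expr1n expr0n addr0 mulr1.
  by rewrite mxE ki nsqc0 mulr0.
pose i0 : 'I_(n.+1 + n.+1) := lshift _ ord0.
have [im lmax] : exists im, forall i, l i <= l im.
  have [im _ h] := @arg_maxP _ _ _ i0 xpredT l isT.
  by exists im => i; apply: h.
exists (l im), (w im); split.
- rewrite vP Pw (bigD1 im) //= big1 ?addr0 => [|k /negPf ki].
    by rewrite mxE !eqxx /nsqc /= expr1n expr0n addr0.
  by rewrite mxE ki nsqc0.
- apply: (can_inj (@compactK _ _)); rewrite compact_mul -/G GE -!mulmxA Pw.
  apply: (can_inj (mulKmx (unitarymx_unit Pu))).
  rewrite (mulmxA P) PP mul1mx.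
  rewrite compactZ -scalemxAr Pw; apply/matrixP => i j.
  rewrite ord1 mul_diag_mx !mxE.
  by have [->|_] := eqVneq i im; [rewrite dl | rewrite !mulr0].
- move=> x.
  have -> : vnsq (A *m x) = \sum_i l i * nsqc ((P *m compact x) i 0).
    apply: complexI; rewrite vA [RHS]rmorph_sum.
    by apply: eq_bigr => i _; rewrite dl -rmorphM.
  rewrite vP mulr_sumr; apply: ler_sum => i _.
  by apply: ler_wpM2r; rewrite ?nsqc_ge0.
Qed.

End ComplexAdjoint.

(** * Singular value decompositions by deflation *)

Section SingularValues.
Variable R : realType.
Local Notation Q := (quat R).

Lemma unitaryq_block1 n (U : 'M[Q]_n) :
  unitaryq U -> unitaryq (block_mx 1%:M 0 0 U : 'M_(1 + n)).
Proof.
move=> [U1 U2]; split; rewrite conjtrq_block conjtrq1 !conjtrq0 mulmx_block;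
  by rewrite !mul0mx !mulmx0 !mulmx1 !addr0 !add0r ?U1 ?U2 -scalar_mx_block.
Qed.

Lemma diagq_cons m n r (d : nat -> R) :
  diagq (1 + m) (1 + n) (fun i => if i is k.+1 then d k else r) =
  block_mx (qreal r)%:M 0 0 (diagq m n d).
Proof.
rewrite -[LHS]submxK; congr block_mx; apply/matrixP => i j;
  by rewrite !mxE ?ord1 //= ?mulr0n.
Qed.

Lemma vnsq_diag_delta m n (d : nat -> R) (j : 'I_n) : (j < m)%N ->
  vnsq (diagq m n d *m delta_mx j 0) = d j ^+ 2.
Proof.
move=> jm; rewrite /vnsq (bigD1 (Ordinal jm)) //= big1 ?addr0 => [|k kj].
  by rewrite -colE !mxE eqxx mulr1n /nsqq /nsqc /=; ring.
apply/eqP; rewrite nsqq_eq0 -colE !mxE.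
suff -> : (k == j :> nat) = false by rewrite mulr0n.
by apply: contraNF kj => /eqP kj; apply/eqP/val_inj.
Qed.

(** Take a unit vector v of maximal gain, s = |A v| and u = A v / s. Then A v = s u and A^* u = s v,
    so unitaries with first columns u and v clear the first row and column off the diagonal. The
    remaining block inherits the gain bound. *)
Lemma max_gain_svd m n (A : 'M[Q]_(m.+1, n.+1)) : A != 0 ->
  exists (s : R) (U : 'M[Q]_m.+1) (V : 'M[Q]_n.+1) (B : 'M[Q]_(m, n)),
  [/\ 0 < s, unitaryq U, unitaryq V,
      A = U *m (block_mx (qreal s)%:M 0 0 B : 'M_(1 + m, 1 + n)) *m conjtrq V &
      forall x, vnsq (B *m x) <= s ^+ 2 * vnsq x].
Proof.
move=> A0; have [l [v [v1 AAv lmax]]] := max_gain_vector A.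
have lE : vnsq (A *m v) = l.
  apply: vnsqP; rewrite conjtrqM -mulmxA (mulmxA _ A) AAv mulmxZq.
  by rewrite conjtrq_mulmx_vnsq v1 !mxE mulr1n rmorph1 mulr1.
have l0 : 0 < l.
  (* A zero maximal gain would force A = 0. *)
  rewrite lt_neqAle -lE vnsq_ge0 andbT eq_sym lE; apply: contraNneq A0 => l0.
  apply/eqP/mulmx_all_eq0 => x; apply/eqP; rewrite -vnsq_eq0 eq_le vnsq_ge0 andbT.
  by apply: le_trans (lmax x) _; rewrite l0 mul0r.
pose s := Num.sqrt l.
have s0 : 0 < s by rewrite sqrtr_gt0.
have sl : s ^+ 2 = l by rewrite sqr_sqrtr ?ltW.
have sN0 : s != 0 by rewrite gt_eqF.
pose u := qreal s^-1 *: (A *m v).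
have u1 : vnsq u = 1 by rewrite /u vnsqZ lE -sl; field.
have Av : A *m v = qreal s *: u.
  by rewrite /u scalerA -rmorphM mulfV // rmorph1 scale1r.
have Au : conjtrq A *m u = qreal s *: v.
  rewrite /u mulmxZq mulmxA AAv scalerA -rmorphM; congr (qreal _ *: _).
  by rewrite -sl; field.
have [U Uu Ue] := unitary_with_col u1.
have [V Vu Ve] := unitary_with_col v1.
have [[U1 U2] [V1 V2]] := (Uu, Vu).
pose M : 'M[Q]_(m.+1, n.+1) := conjtrq U *m A *m V.
have MA : A = U *m M *m conjtrq V.
  by rewrite /M !mulmxA U2 mul1mx -mulmxA V2 mulmx1.
have Mcol : M *m (delta_mx 0 0 : 'cV_n.+1) = qreal s *: (delta_mx 0 0 : 'cV_m.+1).
  by rewrite /M -mulmxA Ve -mulmxA Av mulmxZq -Ue mulmxA U1 mul1mx.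
have Mrow : conjtrq M *m (delta_mx 0 0 : 'cV_m.+1) =
    qreal s *: (delta_mx 0 0 : 'cV_n.+1).
  rewrite /M !conjtrqM conjtrqK -!mulmxA Ue Au mulmxZq -Ve.
  by rewrite mulmxA V1 mul1mx.
have Mc i : M i 0 = qreal s *+ (i == 0).
  have /matrixP/(_ i 0) := Mcol; rewrite -colE !mxE => ->.
  by rewrite andbT mulr_natr.
have Mr j : M 0 j = qreal s *+ (j == 0).
  have /matrixP/(_ j 0) := Mrow; rewrite -colE !mxE => /(congr1 (@conjq R)).
  rewrite conjqK andbT mulr_natr => ->.
  by case: (j == 0); rewrite ?mulr1n ?conjq_qreal // mulr0n raddf0.
clearbody M.
pose B := drsubmx (M : 'M_(1 + m, 1 + n)).
have MB : M = block_mx (qreal s)%:M 0 0 B :> 'M_(1 + m, 1 + n).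
  rewrite -[M in LHS](submxK (M : 'M_(1 + m, 1 + n))); congr block_mx;
    apply/matrixP => i j; rewrite !mxE.
  - by rewrite !ord1 (_ : lshift n 0 = 0) ?Mc //; apply/val_inj.
  - by rewrite !ord1 (_ : lshift m 0 = 0) ?Mr //; apply/val_inj.
  - by rewrite !ord1 (_ : lshift n 0 = 0) ?Mc //; apply/val_inj.
exists s, U, V, B; split => //; first by rewrite -MB.
(* Padding x with a zero on top turns the gain of B into a gain of A. *)
move=> x; pose y : 'cV[Q]_(1 + n) := col_mx 0 x.
have yx : vnsq y = vnsq x by rewrite vnsq_col_mx vnsq0 add0r.
have : vnsq ((M : 'M_(1 + m, 1 + n)) *m y) <= s ^+ 2 * vnsq x.
  have := lmax (V *m y); rewrite (vnsq_mul_unitary _ V1) yx sl.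
  rewrite [in A *m _]MA -!mulmxA (mulmxA _ V) V1 mul1mx.
  by rewrite (vnsq_mul_unitary _ U1).
rewrite MB mul_block_col !mul0mx mulmx0 !addr0 !add0r vnsq_col_mx vnsq0.
by rewrite add0r.
Qed.

(** Induction on the number of columns: [max_gain_svd] splits off the largest singular value, and
    its gain bound on B keeps the sequence nonincreasing. *)
Lemma singvalsq_exists m n (A : 'M[Q]_(m, n)) : exists sv, is_singvalsq A sv.
Proof.
(* Serves the empty matrices as well as A = 0. *)
have zero k l (Z : 'M[Q]_(k, l)) : Z = 0 -> is_singvalsq Z (fun=> 0).
  move=> ->; split=> //; exists 1%:M, 1%:M; split; try exact: unitaryq1.
  rewrite mul1mx conjtrq1 mulmx1; apply/matrixP => i j.
  by rewrite !mxE rmorph0 mul0rn.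
elim: n m A => [|n IHn] [|m] A.
- by exists (fun=> 0); apply: zero; rewrite [A]flatmx0.
- by exists (fun=> 0); apply: zero; rewrite [A]thinmx0.
- by exists (fun=> 0); apply: zero; rewrite [A]flatmx0.
have [->|A0] := eqVneq A 0; first by exists (fun=> 0); apply: zero.
have [s [U [V [B [s0 Uu Vu AE sB]]]]] := max_gain_svd A0.
have [sv [svd sv0 svz [U' [V' [U'u V'u BE]]]]] := IHn _ B.
(* The value [sv 0] is the gain of the first right singular vector of B, or 0 if B is empty. *)
have svs : sv 0%N <= s.
  have [lt0|] := ltnP 0 (minn m n); last by move=> /svz ->; exact: ltW.
  move: lt0; rewrite leq_min => /andP[m0 n0].
  pose x : 'cV[Q]_n := V' *m delta_mx (Ordinal n0) 0.
  have := sB x; rewrite BE /x -!mulmxA (mulmxA _ V').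
  have [[U'1 _] [V'1 _]] := (U'u, V'u).
  rewrite V'1 mul1mx (vnsq_mul_unitary _ U'1) (vnsq_mul_unitary _ V'1).
  rewrite (@vnsq_diag_delta m n sv (Ordinal n0)) // vnsq_delta mulr1.
  by rewrite ler_pXn2r // nnegrE ?sv0 ?ltW.
exists (fun i => if i is k.+1 then sv k else s); split.
- case=> [|i] [|j] // ij; last exact: svd.
  by apply: le_trans svs; apply: svd.
- by case=> [|i]; rewrite ?sv0 ?ltW.
- by case=> [|i]; rewrite minnSS // ltnS; exact: svz.
exists (U *m (block_mx 1%:M 0 0 U' : 'M_(1 + m))).
exists (V *m (block_mx 1%:M 0 0 V' : 'M_(1 + n))); split.
- by apply: unitaryqM => //; exact: unitaryq_block1.
- by apply: unitaryqM => //; exact: unitaryq_block1.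
rewrite [LHS]AE.
have -> : block_mx (qreal s)%:M 0 0 B =
    (block_mx 1%:M 0 0 U' : 'M_(1 + m)) *m
    diagq (1 + m) (1 + n) (fun i => if i is k.+1 then sv k else s) *m
    conjtrq (block_mx 1%:M 0 0 V' : 'M_(1 + n)).
  rewrite diagq_cons conjtrq_block conjtrq1 !conjtrq0 !mulmx_block.
  by rewrite !(mul0mx, mulmx0, mulmx1, mul1mx, addr0, add0r) -BE.
by rewrite conjtrqM !mulmxA.
Qed.

End SingularValues.

(** * Extreme singular values and one step of the iteration *)

Section SingularValueBounds.
Variable R : realType.
Local Notation Q := (quat R).

Lemma singvalqP m n (A : 'M[Q]_(m, n)) : is_singvalsq A (singvalq A).
Proof. exact: xgetPex (singvalsq_exists A). Qed.

(** Unlike in [is_singvalsq], the diagonal may be unsorted and of any sign, since [step] preserves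
    neither order nor, a priori, positivity. *)
Definition svd_form m n (A : 'M[Q]_(m, n)) (U : 'M[Q]_m) (d : nat -> R)
    (V : 'M[Q]_n) : Prop :=
  [/\ unitaryq U, unitaryq V & A = U *m diagq m n d *m conjtrq V].

Lemma singvalq_svd m n (A : 'M[Q]_(m, n)) :
  exists U V, svd_form A U (singvalq A) V.
Proof. by have [_ _ _ [U [V [Uu Vu AE]]]] := singvalqP A; exists U, V. Qed.

Section Tall.
Variables (m n : nat) (A : 'M[Q]_(m, n)).
Hypotheses (n0 : (0 < n)%N) (nm : (n <= m)%N).

Lemma singvalq_bnd i : (i < n)%N ->
  sigma_minq A <= singvalq A i <= sigma_maxq A.
Proof.
move=> i_n; have [dec _ _ _] := singvalqP A.
by apply/andP; split; apply: dec => //; rewrite -ltnS prednK.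
Qed.

Lemma sigma_min_ge0 : 0 <= sigma_minq A.
Proof. by have [_ h _ _] := singvalqP A; apply: h. Qed.

Lemma sigma_min_le_max : sigma_minq A <= sigma_maxq A.
Proof. by have [h _ _ _] := singvalqP A; exact: h. Qed.

Lemma svd_form_gain U d V x : svd_form A U d V ->
  vnsq (A *m x) = \sum_(i < n) d i ^+ 2 * nsqq ((conjtrq V *m x) i 0).
Proof.
move=> [[U1 _] _ ->].
by rewrite -!mulmxA (vnsq_mul_unitary _ U1) vnsq_diag_mul.
Qed.

Lemma svd_form_gain_le U d V h : svd_form A U d V ->
  (forall i, (i < n)%N -> d i ^+ 2 <= h) ->
  forall x, vnsq (A *m x) <= h * vnsq x.
Proof.
move=> svd dh x; rewrite (svd_form_gain _ svd); case: svd => _ [V1 V2] _.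
have /vnsq_mul_unitary <- : conjtrq (conjtrq V) *m conjtrq V = 1%:M.
  by rewrite conjtrqK.
rewrite mulr_sumr; apply: ler_sum => i _; apply: ler_wpM2r; last exact: dh.
exact: nsqq_ge0.
Qed.

Lemma svd_form_gain_ge U d V l : svd_form A U d V ->
  (forall i, (i < n)%N -> l <= d i ^+ 2) ->
  forall x, l * vnsq x <= vnsq (A *m x).
Proof.
move=> svd dl x; rewrite (svd_form_gain _ svd); case: svd => _ [V1 V2] _.
have /vnsq_mul_unitary <- : conjtrq (conjtrq V) *m conjtrq V = 1%:M.
  by rewrite conjtrqK.
rewrite mulr_sumr; apply: ler_sum => i _; apply: ler_wpM2r; last exact: dl.
exact: nsqq_ge0.
Qed.

Lemma svd_form_attained U d V i : svd_form A U d V -> (i < n)%N ->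
  exists2 x, vnsq x = 1 & vnsq (A *m x) = d i ^+ 2.
Proof.
move=> [[U1 _] [V1 _] ->] i_n; exists (V *m delta_mx (Ordinal i_n) 0).
  by rewrite (vnsq_mul_unitary _ V1) vnsq_delta.
rewrite -!mulmxA (mulmxA _ V) V1 mul1mx (vnsq_mul_unitary _ U1).
by rewrite vnsq_diag_delta // (leq_trans i_n).
Qed.

(** With the next three lemmas, this characterises the extreme singular values as extreme gains,
    whichever decomposition is chosen. *)
Lemma gain_le_sigma_max x : vnsq (A *m x) <= sigma_maxq A ^+ 2 * vnsq x.
Proof.
have [U [V svd]] := singvalq_svd A; apply: (svd_form_gain_le svd) => i i_n.
have [_ sv0 _ _] := singvalqP A; have /andP[_ h] := singvalq_bnd i_n.
by rewrite ler_pXn2r // nnegrE; exact: sv0.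
Qed.

Lemma gain_ge_sigma_min x : sigma_minq A ^+ 2 * vnsq x <= vnsq (A *m x).
Proof.
have [U [V svd]] := singvalq_svd A; apply: (svd_form_gain_ge svd) => i i_n.
have [_ sv0 _ _] := singvalqP A; have /andP[h _] := singvalq_bnd i_n.
by rewrite ler_pXn2r // nnegrE; exact: sv0.
Qed.

Lemma sigma_max_sqr_le h :
  (forall x, vnsq (A *m x) <= h * vnsq x) -> sigma_maxq A ^+ 2 <= h.
Proof.
move=> hA; have [U [V svd]] := singvalq_svd A.
have [x x1 <-] := svd_form_attained svd n0.
by rewrite -[h]mulr1 -x1.
Qed.

Lemma sigma_min_sqr_ge l :
  (forall x, l * vnsq x <= vnsq (A *m x)) -> l <= sigma_minq A ^+ 2.
Proof.
move=> hA; have [U [V svd]] := singvalq_svd A.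
have n1 : (n.-1 < n)%N by rewrite prednK.
have [x x1 <-] := svd_form_attained svd n1.
by rewrite -[l]mulr1 -x1.
Qed.

(** The modulus of a diagonal entry is the gain of a unit vector, a column of V. *)
Lemma svd_form_bnd U d V i : svd_form A U d V -> (i < n)%N ->
  sigma_minq A <= `|d i| <= sigma_maxq A.
Proof.
move=> svd i_n; have [x x1 Ax] := svd_form_attained svd i_n.
have := gain_le_sigma_max x; have := gain_ge_sigma_min x.
rewrite x1 !mulr1 Ax -(real_normK (num_real (d i))) => h1 h2.
have [_ sv0 _ _] := singvalqP A.
by move: h1 h2; rewrite !ler_pXn2r ?nnegrE //=; [move=> -> -> | exact: sv0 ..].
Qed.

(** If the last singular value were zero, A would kill the last column of V. *)
Lemma full_col_rank_sigma_min : full_col_rankq A -> 0 < sigma_minq A.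
Proof.
move=> Afull; rewrite lt_neqAle sigma_min_ge0 andbT eq_sym.
apply/eqP => s0; have [U [V svd]] := singvalq_svd A.
have n1 : (n.-1 < n)%N by rewrite prednK.
have [x x1 /eqP] := svd_form_attained svd n1.
rewrite [singvalq _ _]s0 expr0n /= vnsq_eq0 => /eqP/Afull x0.
by move/eqP: x1; rewrite x0 vnsq0 eq_sym oner_eq0.
Qed.

End Tall.

(** Penrose's argument: A X = (A Z)(A X), and taking adjoints of the two Hermitian factors gives A X
    = A Z; likewise X A = Z A. *)
Lemma is_pinvq_unique m n (A : 'M[Q]_(m, n)) X Z :
  is_pinvq A X -> is_pinvq A Z -> X = Z.
Proof.
move=> [AXA XAX AXs XAs] [AZA ZAZ AZs ZAs].
have AXZ : A *m X = A *m Z.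
  by rewrite -[in LHS]AZA -(mulmxA _ A) -AXs -AZs -conjtrqM !mulmxA AXA.
have XZA : X *m A = Z *m A.
  rewrite -[in LHS]AZA -(mulmxA A) (mulmxA X) -XAs -ZAs -conjtrqM.
  by rewrite -mulmxA (mulmxA A X) AXA.
by rewrite -XAX XZA -mulmxA AXZ mulmxA ZAZ.
Qed.

(** The candidate X is a left inverse of A, and A X is the orthogonal projection onto the first n
    columns of U. Uniqueness identifies it with [pinvq A]. *)
Lemma pinvq_svd m n (A : 'M[Q]_(m, n)) U d V : (n <= m)%N ->
  svd_form A U d V -> (forall i, (i < n)%N -> d i != 0) ->
  pinvq A = V *m diagq n m (fun i => (d i)^-1) *m conjtrq U.
Proof.
move=> nm [[U1 U2] [V1 V2] AE] d0; set X := RHS.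
have AX : A *m X = U *m diagq m m (fun i => (i < n)%:R) *m conjtrq U.
  rewrite AE /X !mulmxA -(mulmxA _ _ V) V1 mulmx1 -(mulmxA U) diagq_mul.
  congr (U *m _ *m conjtrq U); apply: eq_diagq => i _.
  by case: ltnP => // i_n; rewrite mulfV ?d0.
have XA : X *m A = 1%:M.
  rewrite AE /X !mulmxA -(mulmxA _ _ U) U1 mulmx1 -(mulmxA V) diagq_mul.
  rewrite (@eq_diagq _ _ _ _ (fun=> 1)) ?diagq1 ?mulmx1 ?V2 // => i.
  by rewrite minnn => i_n; rewrite (leq_trans i_n) // mulVf ?d0.
have pX : is_pinvq A X.
  split; rewrite ?XA ?mul1mx ?conjtrq1 //; first by rewrite -mulmxA XA mulmx1.
  by rewrite AX !conjtrqM conjtrqK conjtrq_diag mulmxA.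
have pA : is_pinvq A (pinvq A) := xgetI 0 pX.
exact: is_pinvq_unique pA pX.
Qed.

(** The adjoint of the pseudoinverse is U diag(1 / d) V^*, so the step takes place on the diagonal
    only. *)
Lemma svd_form_step_gen m n (A : 'M[Q]_(m, n)) U d V e : (n <= m)%N ->
  svd_form A U d V -> (forall i, (i < n)%N -> d i != 0) ->
  svd_form (qreal (1 - e) *: A + qreal e *: conjtrq (pinvq A))
    U (step e \o d) V.
Proof.
move=> nm svd d0; have [Uu Vu AE] := svd; split; [exact: Uu | exact: Vu |].
rewrite (pinvq_svd nm svd d0) !conjtrqM conjtrqK conjtrq_diag mulmxA AE.
have -> : diagq m n (step e \o d) =
    qreal (1 - e) *: diagq m n d + qreal e *: diagq m n (fun i => (d i)^-1).
  apply/matrixP => i j; rewrite !mxE /=.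
  case: eqP => _; last by rewrite !mulr0n !mulr0 addr0.
  by rewrite !mulr1n -!rmorphM -rmorphD.
by rewrite mulmxDr mulmxDl !mulmxZq -!scalemxAl.
Qed.

Lemma svd_form_right_factor m n (A B : 'M[Q]_(m, n)) U d f V :
  svd_form A U d V -> svd_form B U f V -> (forall i, (i < n)%N -> d i != 0) ->
  B = A *m (V *m diagq n n (fun i => f i / d i) *m conjtrq V).
Proof.
move=> [_ [V1 _] ->] [_ _ ->] d0.
rewrite !mulmxA -(mulmxA _ _ V) V1 mulmx1 -(mulmxA U (diagq m n d)) diagq_mul.
congr (U *m _ *m conjtrq V); apply: eq_diagq => i.
by rewrite leq_min => /andP[_ i_n]; rewrite i_n mulr1n mulrC divfK ?d0.
Qed.

Lemma colspanq_mulr m n (A : 'M[Q]_(m, n)) (W W' : 'M[Q]_n) :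
  W *m W' = 1%:M -> colspanq (A *m W) = colspanq A.
Proof.
move=> WW; apply/seteqP; split=> y /= [x _ <-].
  by exists (W *m x); rewrite ?mulmxA.
by exists (W' *m x); rewrite // -mulmxA (mulmxA W) WW mul1mx.
Qed.

Lemma full_col_rank_mulr m n (A : 'M[Q]_(m, n)) (W W' : 'M[Q]_n) :
  W' *m W = 1%:M -> full_col_rankq A -> full_col_rankq (A *m W).
Proof.
move=> WW Af x; rewrite -mulmxA => /Af Wx.
by rewrite -[x]mul1mx -WW -mulmxA Wx mulmx0.
Qed.

End SingularValueBounds.

(** * Effect of one step on singular values and column space *)

Section StepMatrix.
Variables (R : realType) (m n : nat).
Local Notation Q := (quat R).
Hypotheses (n0 : (0 < n)%N) (nm : (n <= m)%N).
Variables (A : 'M[Q]_(m, n)) (e : R).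
Hypothesis Afull : full_col_rankq A.
Let p := sigma_minq A.
Let q := sigma_maxq A.
Let B := qreal (1 - e) *: A + qreal e *: conjtrq (pinvq A).

Lemma sigma_step_gt0 x : p <= x -> x != 0.
Proof.
move=> px; rewrite gt_eqF //.
exact: lt_le_trans (full_col_rank_sigma_min n0 nm Afull) px.
Qed.

Lemma svd_form_step : exists U V,
  svd_form A U (singvalq A) V /\ svd_form B U (step e \o singvalq A) V.
Proof.
have [U [V svd]] := singvalq_svd A; exists U, V; split; first exact: svd.
apply: svd_form_step_gen (svd) _ => // i i_n.
by apply: sigma_step_gt0; case/andP: (singvalq_bnd A n0 i_n).
Qed.

(** As p and q are singular values of A, their images occur on the diagonal for B, up to here with
    unknown sign. *)
Lemma sigma_step_bnd x : x = p \/ x = q ->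
  sigma_minq B <= `|step e x| <= sigma_maxq B.
Proof.
have [U [V [_ svd]]] := svd_form_step.
have n1 : (n.-1 < n)%N by rewrite prednK.
by case=> ->; [exact: (svd_form_bnd n0 nm svd n1)
             | exact: (svd_form_bnd n0 nm svd n0)].
Qed.

Lemma sigma_max_step_le h : (forall x, p <= x <= q -> step e x ^+ 2 <= h) ->
  sigma_maxq B ^+ 2 <= h.
Proof.
move=> hh; have [U [V [_ svd]]] := svd_form_step.
apply: sigma_max_sqr_le => //; apply: (svd_form_gain_le nm svd) => i i_n.
by apply: hh; exact: singvalq_bnd.
Qed.

Lemma sigma_min_step_ge l : (forall x, p <= x <= q -> l <= step e x ^+ 2) ->
  l <= sigma_minq B ^+ 2.
Proof.
move=> hh; have [U [V [_ svd]]] := svd_form_step.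
apply: sigma_min_sqr_ge => //; apply: (svd_form_gain_ge nm svd) => i i_n.
by apply: hh; exact: singvalq_bnd.
Qed.

(** A and B share U and V, so B = A W with W = V diag(step e d / d) V^*, which is invertible once no
    [step e d] vanishes. *)
Lemma colspan_step : (forall x, p <= x <= q -> step e x != 0) ->
  full_col_rankq B /\ colspanq B = colspanq A.
Proof.
move=> hh; have [U [V [svdA svdB]]] := svd_form_step.
have [_ [V1 V2] _] := svdA.
pose W f : 'M[Q]_n := V *m diagq n n f *m conjtrq V.
have Winv f g : (forall i, (i < n)%N -> f i * g i = 1) -> W f *m W g = 1%:M.
  move=> fg; rewrite /W !mulmxA -(mulmxA _ _ V) V1 mulmx1 -(mulmxA V).
  rewrite diagq_mul (@eq_diagq _ _ _ _ (fun=> 1)) ?diagq1 ?mulmx1 ?V2 // => i.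
  by rewrite minnn => i_n; rewrite i_n fg.
pose d := singvalq A.
have d0 i : (i < n)%N -> d i != 0.
  by move=> i_n; apply: sigma_step_gt0; case/andP: (singvalq_bnd A n0 i_n).
have s0 i : (i < n)%N -> step e (d i) != 0.
  by move=> i_n; apply: hh; exact: singvalq_bnd.
have BW : B = A *m W (fun i => step e (d i) / d i).
  exact: svd_form_right_factor svdA svdB d0.
have W1 := Winv (fun i => step e (d i) / d i) (fun i => d i / step e (d i)).
have W2 := Winv (fun i => d i / step e (d i)) (fun i => step e (d i) / d i).
rewrite BW; split.
  apply: (full_col_rank_mulr _ Afull); apply: W2 => i i_n.
  by field; rewrite d0 ?s0.
by apply: colspanq_mulr; apply: W1 => i i_n; field; rewrite d0 ?s0.
Qed.

End StepMatrix.

(** * The starting matrix given by the complex QR decomposition *)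

Section Initial.
Variable R : realType.
Local Notation Q := (quat R).
Local Notation C := R[i].

Definition qcomplex (a : C) : Q := Quat a 0.

Lemma qcomplex_is_zmod_morphism : zmod_morphism qcomplex.
Proof. by move=> a b; apply: quatP; rewrite //= subrr. Qed.
HB.instance Definition _ :=
  GRing.isZmodMorphism.Build C Q qcomplex qcomplex_is_zmod_morphism.
Lemma qcomplex_is_monoid_morphism : monoid_morphism qcomplex.
Proof.
by split=> // a b; apply: quatP; rewrite !(quat0M, quat1M) /= ?rmorph0; ring.
Qed.
HB.instance Definition _ :=
  GRing.isMonoidMorphism.Build C Q qcomplex qcomplex_is_monoid_morphism.

(** [compact] is linear for complex scalars on the right; this transfers the complex QR
    factorisation to quaternion matrices. *)
Lemma compact_mul_complex m n p (A : 'M[Q]_(m, n)) (M : 'M[C]_(n, p)) :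
  compact (A *m map_mx qcomplex M) = compact A *m M.
Proof.
rewrite /compact mul_col_mx; congr col_mx; apply/matrixP => i j; rewrite !mxE.
  rewrite raddf_sum; apply: eq_bigr => k _.
  by rewrite !mxE /= rmorph0 mulr0 subr0.
rewrite raddf_sum rmorph_sum -sumrN /=; apply: eq_bigr => k _.
by rewrite !mxE /= mulr0 add0r rmorphM /= conjCK mulNr.
Qed.

Lemma vnsq_compact_isometry m n (A : 'M[Q]_(m, n)) (x : 'cV[C]_n) :
  (compact A) ^t* *m compact A = 1%:M ->
  vnsq (A *m map_mx qcomplex x) = vnsq (map_mx qcomplex x).
Proof.
move=> AA; apply: complexI.
have sc (r s : C) : r%:M = s%:M :> 'M_1 -> r = s.
  by move/matrixP/(_ 0 0); rewrite !mxE !mulr1n.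
apply: sc; rewrite -!vnsq_compact compact_mul_complex trmx_mul map_mxM mulmxA.
(* Writing x as 1 x reduces the right side to the same computation, as [compact 1] also has
   orthonormal columns. *)
rewrite -(mulmxA _ _ (compact A)) AA mulmx1 -[map_mx qcomplex x]mul1mx.
rewrite compact_mul_complex trmx_mul map_mxM mulmxA -(mulmxA _ _ (compact _)).
suff -> : (compact (1%:M : 'M[Q]_n)) ^t* *m compact (1%:M : 'M[Q]_n) = 1%:M.
  by rewrite mulmx1.
rewrite /compact (_ : map_mx (@quat0 R) 1%:M = 1%:M); last first.
  by apply/matrixP => i j; rewrite !mxE; case: eqP.
rewrite (_ : map_mx (fun x : Q => (quat1 x)^*) 1%:M = 0); last first.
  by apply/matrixP => i j; rewrite !mxE; case: eqP => _; rewrite /= rmorph0.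
rewrite oppr0 tr_col_mx map_row_mx mul_row_col mulmx0 addr0.
by rewrite trmx1 map_mx1 mulmx1.
Qed.

Lemma vnsqD_le n (x y : 'cV[Q]_n) : vnsq (x + y) <= 2 * (vnsq x + vnsq y).
Proof.
rewrite /vnsq -big_split /= mulr_sumr; apply: ler_sum => i _; rewrite mxE.
case: (x i 0) (y i 0) => [[a b] [c d]] [[a' b'] [c' d']].
rewrite /nsqq /nsqc /=.
have := sqr_ge0 (a - a'); have := sqr_ge0 (b - b').
have := sqr_ge0 (c - c'); have := sqr_ge0 (d - d').
lra.
Qed.

(* x = x0 + x1 j, where j acts on the right. *)
Lemma vnsq_split n (x : 'cV[Q]_n) : exists x0 x1 : 'cV[C]_n,
  x = map_mx qcomplex x0 + map_mx qcomplex x1 *m (Quat 0 1)%:M /\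
  vnsq x = vnsq (map_mx qcomplex x0) + vnsq (map_mx qcomplex x1).
Proof.
exists (map_mx (@quat0 R) x), (map_mx (@quat1 R) x); split.
  apply/matrixP => i j; rewrite ord1 !mxE big_ord1 !mxE mulr1n.
  by apply: quatP; rewrite /= ?rmorph0 ?rmorph1; ring.
rewrite /vnsq -big_split; apply: eq_bigr => i _.
by rewrite !mxE /nsqq /= nsqc0 !addr0.
Qed.

(** A complex unit vector keeps its norm, so 1 lies between the extremes. For x = x0 + x1 j both
    parts keep their norms, and |a + b|^2 <= 2 (|a|^2 + |b|^2) gives the bound 2. *)
Lemma isometry_sigma_bnd m n (A : 'M[Q]_(m, n)) : (0 < n)%N -> (n <= m)%N ->
  (compact A) ^t* *m compact A = 1%:M ->
  [/\ sigma_minq A <= 1, 1 <= sigma_maxq A & sigma_maxq A ^+ 2 <= 2].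
Proof.
move=> n0 nm AA.
pose x : 'cV[Q]_n := map_mx qcomplex (delta_mx (Ordinal n0) 0).
have x1 : vnsq x = 1 by rewrite /x map_delta_mx vnsq_delta.
have Ax : vnsq (A *m x) = 1 by rewrite vnsq_compact_isometry.
have p0 := sigma_min_ge0 A; have pq := sigma_min_le_max A.
have := gain_le_sigma_max A n0 nm x; have := gain_ge_sigma_min A n0 nm x.
rewrite Ax x1 !mulr1 => h1 h2; split; try by nra.
apply: sigma_max_sqr_le => // y; have [y0 [y1 [-> ->]]] := vnsq_split y.
rewrite mulmxDr; apply: le_trans (vnsqD_le _ _) _; rewrite mulmxA vnsq_mulr.
rewrite !vnsq_compact_isometry // (_ : nsqq _ = 1) ?mulr1 //.
by rewrite /nsqq /nsqc /=; ring.
Qed.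

(** Injectivity of [compact] gives Y = H T over the quaternions, and T is invertible because a
    complex kernel vector of T would be killed by Y. *)
Lemma thin_QR_right_factor m n (Y H : 'M[Q]_(m, n)) (T : 'M[C]_n) :
  compact Y = compact H *m T -> full_col_rankq Y ->
  full_col_rankq H /\ colspanq H = colspanq Y.
Proof.
rewrite -compact_mul_complex => /(can_inj (@compactK _ _ _)) YE Yf.
have Tu : T \in unitmx.
  rewrite unitmxE unitfE -det_tr; apply/negP => /det0P[v v0 vT].
  case/negP: v0; apply/eqP.
  have /(congr1 (map_mx (@quat0 R))) : map_mx qcomplex v^T = 0.
    apply: Yf; rewrite YE -mulmxA -map_mxM -[T]trmxK -trmx_mul vT trmx0.
    by rewrite map_mx0 mulmx0.
  rewrite -map_mx_comp map_mx0 => /(congr1 trmx).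
  by rewrite trmx0 map_mx_id // trmxK.
have TT : map_mx qcomplex T *m map_mx qcomplex (invmx T) = 1%:M.
  by rewrite -map_mxM mulmxV // map_mx1.
have HY : H = Y *m map_mx qcomplex (invmx T) by rewrite YE -mulmxA TT mulmx1.
split; last by rewrite YE (colspanq_mulr _ TT).
by rewrite HY; apply: full_col_rank_mulr TT Yf.
Qed.

End Initial.

(** * From matrix steps to the three iterations *)

Lemma sigma_step_bounds (R : realType) m n (A : 'M[quat R]_(m, n)) d e :
  (0 < n)%N -> (n <= m)%N -> full_col_rankq A ->
  sigma_minq A <= e <= d * sigma_minq A ->
  zero_free d (sigma_minq A) (sigma_maxq A) ->
  let B := qreal (1 - e) *: A + qreal e *: conjtrq (pinvq A) in
  [/\ full_col_rankq B, colspanq B = colspanq A &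
      step_bounds e (sigma_minq A) (sigma_maxq A) (sigma_minq B) (sigma_maxq B)].
Proof.
move=> n0 nm Af he reg B.
have p0 := full_col_rank_sigma_min n0 nm Af.
(* Positivity on the whole interval preserves the rank and removes the absolute values. *)
have pos x : sigma_minq A <= x <= sigma_maxq A -> 0 < step e x.
  by move=> hx; exact: (step_gt0 p0 hx he reg).
have [Bf BA] := colspan_step n0 nm Af (fun x hx => lt0r_neq0 (pos x hx)).
have pq := sigma_min_le_max A.
have q'0 : 0 <= sigma_maxq B.
  by apply: le_trans (sigma_min_le_max B); exact: sigma_min_ge0.
split=> //; split.
- by rewrite (full_col_rank_sigma_min n0 nm Bf) sigma_min_le_max.
- move=> x hx; have := sigma_step_bnd n0 nm e Af hx; rewrite gtr0_norm //.
  by apply: pos; case: hx => ->; rewrite lexx pq.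
- move=> h hx.
  have hp : sigma_minq A <= sigma_minq A <= sigma_maxq A by rewrite lexx pq.
  (* Nonnegativity of h allows the comparison to be made on squares. *)
  have h0 : 0 <= h := le_trans (ltW (pos _ hp)) (hx _ hp).
  rewrite -(@ler_pXn2r _ 2) ?nnegrE //.
  apply: (sigma_max_step_le n0 nm Af) => x px.
  by rewrite ler_pXn2r ?nnegrE ?hx // ltW ?pos.
- by move=> l hl; apply: (sigma_min_step_ge n0 nm Af).
Qed.

Theorem proposition3p4 (R : realType) (m s : nat) (s_gt0 : (0 < s)%N)
    (lt_sm : (s < m)%N)
    (Y : 'M[quat R]_(m, s)) (Yfull : full_col_rankq Y)
    (Q : 'M[R[i]]_(m + m, s)) (T : 'M[R[i]]_s)
    (YQT : thin_QR (compact Y) Q T)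
    (delta : R) (delta_bnd : 1 <= delta <= Num.sqrt 7 / 2)
    (H : nat -> 'M[quat R]_(m, s)) (eps : nat -> R)
    (H0Q : compact (H 0%N) = Q)
    (eps_bnd : forall k : nat, (k < 3)%N ->
       sigma_minq (H k) <= eps k <= delta * sigma_minq (H k))
    (HS : forall k : nat, (k < 3)%N ->
       H k.+1 = qreal (1 - eps k) *: H k
                + qreal (eps k) *: conjtrq (pinvq (H k))) :
  colspanq (H 3%N) = colspanq Y /\
  ((forall k : nat, (k < 3)%N ->
      Num.max (2 * Num.sqrt 2 * delta) (2 * delta ^+ 2 + 1 / 2)
        < kappaq (H k)) ->
   kappaq (H 0%N) < 10 ^+ 8 ->
   kappaq (H 3%N) < 10).
Proof.
have nm := ltnW lt_sm.
have hd : 0 <= delta <= dmax R.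
  case/andP: delta_bnd => d1 d2; apply/andP; split; first by lra.
  apply: le_trans d2 _.
  (* The square of 127/48 barely exceeds 7. *)
  have : Num.sqrt 7 <= 127 / 48 :> R.
    apply: (@le_of_sqr_le _ _ _ 7); [by lra | exact: sqrtr_ge0 | by lra |].
    by rewrite sqr_sqrtr //; lra.
  by rewrite /dmax; lra.
have d1 : 1 <= delta by case/andP: delta_bnd.
case: YQT => YE QQ _; rewrite -H0Q in YE QQ.
have [H0f H0Y] := thin_QR_right_factor YE Yfull.
have [p01 q01 q02] := isometry_sigma_bnd s_gt0 nm QQ.
have p00 := full_col_rank_sigma_min s_gt0 nm H0f.
pose p k := sigma_minq (H k); pose q k := sigma_maxq (H k).
have next k : (k < 3)%N -> full_col_rankq (H k) -> zero_free delta (p k) (q k) ->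
    [/\ full_col_rankq (H k.+1), colspanq (H k.+1) = colspanq (H k) &
        step_bounds (eps k) (p k) (q k) (p k.+1) (q k.+1)].
  move=> k3 Hf reg; rewrite /p /q HS //.
  exact: (sigma_step_bounds s_gt0 nm Hf (eps_bnd k k3) reg).
have q0h : q 0%N <= hmax R.
  apply: (@le_of_sqr_le _ _ _ 2);
    [by rewrite /hmax; lra | by rewrite /q; lra | | exact: q02].
  by rewrite /hmax; lra.
(* With p <= 1 and q^2 <= 2 it is enough that delta < 2. *)
have reg0 : zero_free delta (p 0%N) (q 0%N).
  rewrite /zero_free; have [_ d2] := andP hd; rewrite /dmax in d2.
  have h1 : 1 <= q 0%N ^+ 2 by apply: exprn_ege1.
  have h2 : delta * p 0%N <= delta * 1 by apply: ler_wpM2l => //; lra.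
  have : delta * p 0%N * (q 0%N ^+ 2 - 1) <= delta * 1 * (q 0%N ^+ 2 - 1).
    by apply: ler_wpM2r => //; lra.
  by move: q02; rewrite -/(q 0%N); nra.
have [H1f H1c nb0] := next 0%N isT H0f reg0.
have [p10 _ _ _] := nb0; have {}p10 : 0 < p 1%N by case/andP: p10.
(* For eps > 1 the lower bound on q 1 comes from p 0 <= 1, whose image is at least 1. *)
have [q1b reg1] : 1 <= q 1%N <= hmax R /\ zero_free delta (p 1%N) (q 1%N).
  have [pe ed] := andP (eps_bnd 0%N isT).
  have [e1|e1] := lerP (eps 0%N) 1.
    by apply: (step_bounds_le1 hd p00 _ e1 _ nb0); rewrite ?pe // q01.
  have [qd reg] := step_bounds_ge1 hd p00 ed (ltW e1) nb0; split=> //.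
  have [_ /(_ _ (or_introl erefl)) /andP[_ q1] _ _] := nb0.
  rewrite (le_trans (step_ge1 p00 p01 pe) q1) /=; apply: le_trans qd _.
  by rewrite /dmax /hmax; lra.
have [H2f H2c nb1] := next 1%N isT H1f reg1.
have [p20 _ _ _] := nb1; have {}p20 : 0 < p 2%N by case/andP: p20.
have reg2 : zero_free delta (p 2%N) (q 2%N).
  have [pe ed] := andP (eps_bnd 1%N isT).
  have [e1|e1] := lerP (eps 1%N) 1.
    by have [] := step_bounds_le1 hd p10 (eps_bnd 1%N isT) e1 q1b nb1.
  by have [] := step_bounds_ge1 hd p10 ed (ltW e1) nb1.
have [H3f H3c nb2] := next 2%N isT H2f reg2.
have [p30 _ _ _] := nb2; have {}p30 : 0 < p 3%N by case/andP: p30.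
split; first by rewrite H3c H2c H1c.
move=> hkap kap0.
have r2 : 7 / 5 <= Num.sqrt 2 :> R.
  apply: (@le_of_sqr_le _ _ _ 2); [exact: sqrtr_ge0 | by lra | | by lra].
  by rewrite sqr_sqrtr //; lra.
(* Used alternately with [step_bounds_le1]: the bound on q k limits eps k, and this bounds q at the
   next index. *)
have epsle k : (k < 3)%N -> 0 < p k -> q k <= hmax R -> eps k <= 11 / 20.
  move=> k3 pk qk; have /andP[_ ed] := eps_bnd k k3.
  apply: (eps_le_of_ratio d1 pk qk r2 ed).
  by have := hkap k k3; rewrite gt_max => /andP[].
have e1 k : eps k <= 11 / 20 -> eps k <= 1 by move=> h; lra.
have e0 := epsle 0%N isT p00 q0h.
have ee1 := epsle 1%N isT p10 (proj2 (andP q1b)).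
have [q2b _] := step_bounds_le1 hd p10 (eps_bnd 1%N isT) (e1 _ ee1) q1b nb1.
have ee2 := epsle 2%N isT p20 (proj2 (andP q2b)).
have [q3b _] := step_bounds_le1 hd p20 (eps_bnd 2%N isT) (e1 _ ee2) q2b nb2.
have lo k : (k < 3)%N -> eps k <= 11 / 20 -> p k <= eps k <= 11 / 20.
  by move=> k3 ->; case/andP: (eps_bnd k k3) => ->.
have a0 := step_bounds_min_sqr_ge p00 (lo 0%N isT e0) nb0.
have a1 := step_bounds_min_sqr_ge p10 (lo 1%N isT ee1) nb1.
have a2 := step_bounds_min_sqr_ge p20 (lo 2%N isT ee2) nb2.
(* Here t = 1/10, so that the inverse of t^8 is 10^8. *)
rewrite -[10]invrK; apply: (ratio_after_three_steps _ p00 p10 p20 p30 q01 _ a0 a1 a2).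
- by rewrite invr_gt0; lra.
- by case/andP: q3b.
- by rewrite exprVn invrK.
Qed.
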